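(* Let $E\in\overline{\mathscr K}$ be a nearly closed subset of $\overline{\mathbb R}$ and let $X$ be a skip-free Hunt process (SFH) on $E$. There exists a continuous and strictly increasing real valued function $\mathbf s$ on $E$ such that for any $a,x,b\in E$ with $a<x<b$, $$\mathbf P_x(T_b<T_a)=\frac{\mathbf s(x)-\mathbf s(a)}{\mathbf s(b)-\mathbf s(a)}.$$ If $\tilde{\mathbf s}$ is another function with the same properties, then $\tilde{\mathbf s}=\alpha\mathbf s+\beta$ with $\alpha>0$ and $\beta\in\mathbb R$.
   Context: **Nearly closed sets.** Let $\overline{\mathbb R}=[-\infty,\infty]$. For $E\subset\overline{\mathbb R}$ put $l=\inf E$, $r=\sup E$. $E$ is a nearly closed subset of $\overline{\mathbb R}$ ($E\in\overline{\mathscr K}$) if $\overline E:=E\cup\{l,r\}$ is closed in $\overline{\mathbb R}$. Cemetery: $E_\partial=E\cup\{\partial\}$, where $\partial$ is an additional isolated point if $E=\overline E$; $\partial$ is identified with $l$ (resp. $r$) if $E=\overline E\setminus\{l\}$ (resp. $E=\overline E\setminus\{r\}$); $E_\partial$ is the one-point compactification of $E$ if $E=\overline E\setminus\{l,r\}$. **SFH.** A Hunt process $X=(\Omega,\mathscr F_t,\theta_t,X_t,\mathbf P_x,\zeta)$ on $E_\partial$ (with $\{\mathscr F_t\}$ the minimum augmented admissible filtration and lifetime $\zeta=\inf\{t>0:X_t=\partial\}$) is a skip-free Hunt process on $E$ if: (SF) for all $x\in E$, $\mathbf P_x$-a.s., $(X_{t-}\wedge X_t,\,X_{t-}\vee X_t)\cap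 E=\emptyset$ for all $t<\zeta$; (SR) $\mathbf P_x(T_y<\infty)>0$ for all $x,y\in E$, where $T_y:=\inf\{t>0:X_t=y\}$, $\inf\emptyset:=\infty$; (SK) if $\mathbf P_x(\zeta<\infty)>0$ for some $x\in E$, then $l\notin E$ or $r\notin E$, and $\mathbf P_x(X_{\zeta-}\notin E,\zeta<\infty)=\mathbf P_x(\zeta<\infty)$. *)

(* Defs.v *)
From HB Require Import structures.
From mathcomp Require Import all_boot all_order all_algebra.
From mathcomp Require Import all_classical all_reals all_analysis.

Set Implicit Arguments.
Unset Strict Implicit.
Unset Printing Implicit Defensive.

Import Order.TTheory GRing.Theory Num.Theory.
Import numFieldNormedType.Exports.

Local Open Scope classical_set_scope.
Local Open Scope ring_scope.
Local Open Scope ereal_scope.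

Definition nearly_closed (R : realType) (E : set (\bar R)) : Prop :=
  closed (E `|` [set ereal_inf E; ereal_sup E]).

(* The carrier of E_∂ is [option E] with ∂ = [None].  "∂ is identified with l"
   means that the neighbourhoods of ∂ are the traces on E of those of l. *)
Definition cemetery (R : realType) (E : set (\bar R)) : Type := option E.

Section cemetery_topology.
Context {R : realType} {E : set (\bar R)}.
Local Notation Ed := (cemetery E).

HB.instance Definition _ := Choice.on Ed.
HB.instance Definition _ := Pointed.on Ed.

Definition identified_nbhs (e : \bar R) : set_system Ed :=
  [set A | A None /\
           \forall y \near e, forall x : E, set_val x = y -> A (Some x)].

Definition cemetery_nbhs (p : Ed) : set_system Ed :=
  match p with
  | Some x => Some @ nbhs x
  | None =>
    match pselect (E (ereal_inf E)), pselect (E (ereal_sup E)) with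
    | left _, left _ => [set A | A None]
    | right _, left _ => identified_nbhs (ereal_inf E)
    | left _, right _ => identified_nbhs (ereal_sup E)
    | right _, right _ => nbhs (None : one_point_compactification E)
    end
  end.

Let identified_filter e : ProperFilter (identified_nbhs e).
Proof.
apply: Build_ProperFilter_ex.
- by move=> A [A0 _]; exists None.
- split.
  + by split=> //; apply: nearW.
  + move=> A B [A0 An] [B0 Bn]; split; first by split.
    near=> y => x xy; split; [exact: (near An y)|exact: (near Bn y)].
  + move=> A B AB [A0 An]; split; first exact: AB.
    by apply: filterS An => y Ay x /Ay /AB.
Unshelve. all: by end_near. Qed.

Let identified_nbhs_nbhs e (A : set Ed) :
  identified_nbhs e A ->
  identified_nbhs e [set p | (if p is Some x then (Some @ nbhs x) A
                              else identified_nbhs e A)].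
Proof.
move=> [A0 An]; split; first by split.
move: (An); rewrite /prop_near1 nbhsE => -[U [oU Ue] UA].
exists U => // y Uy x xy.
have : nbhs x (set_val @^-1` U).
  apply: (@initial_continuous E (\bar R) set_val).
  by apply: open_nbhs_nbhs; split => //; rewrite xy.
by apply: filterS => z Uz; exact: (UA _ Uz z erefl).
Qed.

Let cemetery_filter p : ProperFilter (cemetery_nbhs p).
Proof.
case: p => [x|] /=; first exact: fmap_proper_filter.
case: pselect => ?; case: pselect => ?; last exact: (@nbhs_pfilter (one_point_compactification E)).
2,3: exact: identified_filter.
apply: Build_ProperFilter_ex; first by move=> A ?; exists None.
by split=> // A B AB; exact: AB.
Qed.

Let cemetery_singleton p A : cemetery_nbhs p A -> A p.
Proof.
case: p => [x /= /nbhs_singleton//|] /=.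
case: pselect => ?; case: pselect => ? //.
1,2: by case.
exact: (@nbhs_singleton (one_point_compactification E)).
Qed.

Let cemetery_nbhs_nbhs p A :
  cemetery_nbhs p A -> cemetery_nbhs p (cemetery_nbhs^~ A).
Proof.
case: p => [x|].
  rewrite /= nbhs_simpl nbhsE => -[U [oU Ur] USA/=].
  by exists U => //= z /=; rewrite nbhs_simpl nbhsE => Uz; exists U.
rewrite /cemetery_nbhs.
case: pselect => ?; case: pselect => ? //.
- move=> /identified_nbhs_nbhs.
  by apply: (@filterS _ _ (identified_filter _)) => -[].
- move=> /identified_nbhs_nbhs.
  by apply: (@filterS _ _ (identified_filter _)) => -[].
- move=> /(@nbhs_interior (one_point_compactification E)).
  by apply: (@filterS _ _ (@nbhs_filter (one_point_compactification E) _)) => -[].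
Qed.

HB.instance Definition _ := hasNbhs.Build Ed cemetery_nbhs.
HB.instance Definition _ := @Nbhs_isNbhsTopological.Build Ed
  cemetery_filter cemetery_singleton cemetery_nbhs_nbhs.

End cemetery_topology.

Section mixture.
Context d d' (S : measurableType d) (T : measurableType d') (R : realType).
Variables (k : R.-pker S ~> T) (mu : probability S R).

Definition mixture (A : set T) : \bar R := \int[mu]_x k x A.

Let mixture0 : mixture set0 = 0.
Proof. by apply: integral0_eq => x _; rewrite measure0. Qed.

Let mixture_ge0 A : 0 <= mixture A.
Proof. by apply: integral_ge0 => x _. Qed.

Let mixture_sigma_additive : semi_sigma_additive mixture.
Proof.
move=> F mF tF mUF; rewrite /mixture.
under [X in _ --> X]eq_integral => x _.
  rewrite measure_semi_bigcup//; over.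
rewrite /= integral_nneseries//; last by move=> n; exact: measurable_kernel.
by apply: is_cvg_nneseries => n _ _; exact: integral_ge0.
Qed.

HB.instance Definition _ := isMeasure.Build d' T R mixture
  mixture0 mixture_ge0 mixture_sigma_additive.

Let mixture_setT : mixture setT = 1.
Proof.
rewrite /mixture; under eq_integral do rewrite prob_kernel.
rewrite integral_cst// mul1e; exact: probability_setT.
Qed.

HB.instance Definition _ := Measure_isProbability.Build d' T R mixture
  mixture_setT.

End mixture.

Definition borel_cemetery (R : realType) (E : set (\bar R)) : Type :=
  g_sigma_algebraType (@open (cemetery E)).
HB.instance Definition _ (R : realType) (E : set (\bar R)) :=
  Measurable.on (borel_cemetery E).

(* Time ranges over [0, +oo], as a part of [\bar R]; the values of a process at
   negative times are never used. *)
Definition cylinders (R : realType) (E : set (\bar R)) (Omega : Type)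
    (X : \bar R -> Omega -> cemetery E) (t : \bar R) : set_system Omega :=
  [set X s @^-1` B | s in [set s | 0 <= s <= t] & B in <<s @open (cemetery E) >>].

Definition path_space (R : realType) (E : set (\bar R)) (Omega : pointedType)
    (X : \bar R -> Omega -> cemetery E) : Type :=
  g_sigma_algebraType (cylinders X +oo).
HB.instance Definition _ (R : realType) (E : set (\bar R))
    (Omega : pointedType) (X : \bar R -> Omega -> cemetery E) :=
  Measurable.on (path_space X).

Section process.
Context {R : realType} {E : set (\bar R)} {Omega : pointedType}.
Local Notation Ed := (cemetery E).
Local Notation "∂" := (None : Ed).
Variables (X : \bar R -> Omega -> Ed) (theta : \bar R -> Omega -> Omega).
Variable P : R.-pker (borel_cemetery E) ~> (path_space X).

(* The minimum augmented admissible filtration: for each initial law mu, add to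
   sigma(X_s, s <= t) the P_mu-negligible sets, then intersect over mu. At
   t = +oo this is the intersection of the P_mu-completions. *)
Definition filtration (t : \bar R) : set_system Omega :=
  [set A | forall mu : probability (borel_cemetery E) R,
    <<s cylinders X t `|` (mixture P mu).-negligible >> A].

Definition stopping_time (T : Omega -> \bar R) : Prop :=
  (forall w, 0 <= T w) /\
  (forall t, 0 <= t -> filtration t [set w | T w <= t]).

Definition stopped_filtration (T : Omega -> \bar R) : set_system Omega :=
  [set A | forall t, 0 <= t -> filtration t (A `&` [set w | T w <= t])].

Definition hitting (y : Ed) (w : Omega) : \bar R :=
  ereal_inf [set t | 0 < t /\ X t w = y].

Definition lifetime : Omega -> \bar R := hitting ∂.

Definition left_limit (t : R) (w : Omega) (p : Ed) : Prop :=
  X s%:E w @[s --> t^'-] --> p.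

(* Hitting events are measurable only after completion, so P_mu and P_x are
   taken on the completed sigma-algebras. *)
Local Notation Pmu mu :=
  (@completed_measure_extension _ _ _ (mixture P mu)).
Local Notation Px x :=
  (@completed_measure_extension _ _ _ (P (Some x : Ed))).

Record hunt_process : Prop := {
  hunt_infty : forall w, X +oo w = ∂ ;
  hunt_absorbing : forall w t, 0 <= t -> lifetime w <= t -> X t w = ∂ ;
  hunt_shift : forall s t w, 0 <= s -> 0 <= t ->
    X s (theta t w) = X (s + t) w ;
  hunt_right_continuous : forall w (t : R), 0 <= t%:E ->
    X s%:E w @[s --> t^'+] --> X t%:E w ;
  hunt_left_limit : forall w (t : R), 0 < t%:E -> exists p, left_limit t w p ;
  hunt_normal : forall x : Ed, P x [set w | X 0 w = x] = 1 ;
  hunt_cemetery : forall t, 0 <= t -> P ∂ [set w | X t w = ∂] = 1 ;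
  (* P_mu(X_{T+s} \in B | F_T) = P_{X_T}(X_s \in B), integrated over A in F_T *)
  hunt_strong_markov : forall (mu : probability (borel_cemetery E) R) T (s : R)
      (B : set (borel_cemetery E)) (A : set Omega),
    stopping_time T -> 0 <= s%:E -> measurable B -> stopped_filtration T A ->
    Pmu mu (A `&` [set w | B (X (T w + s%:E) w)]) =
    \int[Pmu mu]_(w in A) P (X (T w) w) (X s%:E @^-1` B) ;
  hunt_quasi_left_continuous : forall (mu : probability (borel_cemetery E) R)
      (T_ : nat -> Omega -> \bar R) (T : Omega -> \bar R),
    (forall n, stopping_time (T_ n)) -> stopping_time T ->
    (forall w, nondecreasing_seq (T_ ^~ w)) ->
    (forall w, T_ n w @[n --> \oo] --> T w) ->
    {ae mixture P mu, forall w, T w < +oo ->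
      X (T_ n w) w @[n --> \oo] --> X (T w) w}
}.

Definition skip_free : Prop := forall x : E,
  {ae P (Some x), forall w, forall t : R, 0 < t%:E < lifetime w ->
    forall u v : E, left_limit t w (Some u) -> X t%:E w = Some v ->
    [set z | mine (set_val u) (set_val v) < z < maxe (set_val u) (set_val v)]
      `&` E = set0}.

Definition skip_free_regular : Prop := forall x y : E,
  0 < Px x [set w | hitting (Some y) w < +oo].

(* X_{ζ-} \notin E means X_{ζ-} = ∂. *)
Definition skip_free_killing : Prop := forall x : E,
  0 < Px x [set w | lifetime w < +oo] ->
  (~ E (ereal_inf E) \/ ~ E (ereal_sup E)) /\
  Px x [set w | exists t : R,
          [/\ 0 < t%:E, lifetime w = t%:E & left_limit t w ∂]] =
  Px x [set w | lifetime w < +oo].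

Definition skip_free_hunt : Prop :=
  [/\ hunt_process, skip_free, skip_free_regular & skip_free_killing].

Definition scale_function (s : E -> R) : Prop :=
  [/\ continuous s,
      (forall x y : E, set_val x < set_val y -> (s x < s y)%R) &
      forall a x b : E, set_val a < set_val x < set_val b ->
        Px x [set w | hitting (Some b) w < hitting (Some a) w] =
        ((s x - s a) / (s b - s a))%:E].

End process.

(* Main.v *)
Require Import Defs.
From HB Require Import structures.
From mathcomp Require Import all_boot all_order all_algebra.
From mathcomp Require Import all_classical all_reals all_analysis.
From mathcomp Require Import measurable_realfun ring lra.

(**
  Replace the hitting time [T_y] by the entrance time [D_y], the first time at
  which the running supremum (or infimum, according to the position of the
  starting point) reaches y; it sees left limits as well as values, so that its level
  sets are determined by rational times and it is a stopping time for the
  filtration without any right-continuity assumption.  Almost surely [D_y] is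
  the hitting time of y: if the path jumps at [D_y] it does so over no point
  of E, and if the left limit is y (or the cemetery) then quasi-left-continuity,
  applied to the entrance times of levels increasing to y, identifies the value
  with the left limit.

  Write [p(a,x,b)] for the probability to reach b before a from x.
  - From a the path has to visit x before b, hence [P_x(D_b <= t)] is at least
    [P_a(D_b <= t) > 0] for all x in ]a,b[; by the Markov property the process
    leaves ]a,b[ in finite time, and the killing condition forbids to die inside.
  - [0 < p(a,x,b) < 1]: otherwise going from x to b requires going to a first,
    which forces [P_x(D_b <= t) = 0] for all t.
  - The strong Markov property gives [p(a,x,z) = p(a,x,y) p(a,y,z)] for
    a < x < y < z and the mirror identity for [1 - p].
  These facts alone produce the scale function, normalised at two points c < d,
  and its uniqueness.  Continuity is continuity of the probability along the
  entrance times of levels increasing to a point.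
*)

Set Implicit Arguments.
Unset Strict Implicit.
Unset Printing Implicit Defensive.

Import Order.TTheory GRing.Theory Num.Theory.
Import numFieldNormedType.Exports.

Local Open Scope classical_set_scope.
Local Open Scope ring_scope.
Local Open Scope ereal_scope.

(** * Extended reals and the topology of the cemetery space *)

(** The Markov property is given for the position at one time after T, while entrance times depend
    on the whole later path. It is extended to all events of the shifted path by induction on the
    number of times and uniqueness of measures on a pi-system. Shifted events are measurable only
    after completion, so events are compared almost surely, through the completed measure.
    Statements on paths carry a direction [b]: reversing the order of the line exchanges upward and
    downward crossings, and the identity for 1 - p is the one for p read upside down. The cemetery
    enters through one fact: points near it leave every segment with endpoints in E. With the
    killing condition this rules out death inside ]a,b[. The scale function is local at first: z ->
    p(A,z,B) satisfies the scale identity on [A,B] only, and E may have no extreme points. Since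
    such a function is fixed, up to an affine map, by its values at c and d, all of them agree once
    normalised there, and they glue. *)

Section ereal_approximation.
Context {R : realType}.
Implicit Types (x y c : \bar R).

Lemma ereal_rat_dense x y :
  x < y -> exists2 q : rat, x < (ratr q)%:E & (ratr q)%:E < y.
Proof.
case: x => [x| |]; case: y => [y| |] //.
- rewrite lte_fin => /rat_in_itvoo[q]; rewrite in_itv/= => /andP[xq qy].
  by exists q; rewrite lte_fin.
- move=> _; have /rat_in_itvoo[q] : (x < x + 1)%R by rewrite ltrDl.
  by rewrite in_itv/= => /andP[xq _]; exists q; rewrite ?ltry ?lte_fin.
- move=> _; have /rat_in_itvoo[q] : (y - 1 < y)%R by rewrite gtrDl ltrN10.
  by rewrite in_itv/= => /andP[_ qy]; exists q; rewrite ?ltNyr ?lte_fin.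
- by move=> _; exists 0%R; rewrite ?ltNyr ?ltry.
Qed.

(** The levels to which quasi-left-continuity is applied: they increase to [c], and stay strictly
    below it unless [c] is -oo. *)
Definition below c (n : nat) : \bar R :=
  match c with
  | r%:E => (r - n.+1%:R^-1)%:E
  | +oo => n%:R%:E
  | -oo => -oo
  end.

Lemma below_nd c : nondecreasing_seq (below c).
Proof.
case: c => [r| |] m n mn //=.
- by rewrite lee_fin lerD2l lerN2 lef_pV2 ?posrE// ler_nat.
- by rewrite lee_fin ler_nat.
Qed.

Lemma below_lt c n : -oo < c -> below c n < c.
Proof.
case: c => [r| |] //= _; last by rewrite ltry.
by rewrite lte_fin gtrDl oppr_lt0 invr_gt0.
Qed.

Lemma below_gt c x : x < c -> exists n, x < below c n.
Proof.
case: c => [r| |] //=.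
- case: x => [x| |] //; last by exists 0%N; rewrite ltNyr.
  rewrite lte_fin => /ltr_add_invr[k xk].
  by exists k; rewrite lte_fin ltrBrDr.
- case: x => [x| |] // _; last by exists 0%N; rewrite ltNyr.
  by exists (Num.bound x); rewrite lte_fin unstable.ltr_bound.
- by rewrite ltNge leNye.
Qed.

Lemma below_le c x : (forall n, below c n <= x) -> c <= x.
Proof. by move=> h; rewrite leNgt; apply/negP => /below_gt[n]; rewrite ltNge h. Qed.

End ereal_approximation.

Section cemetery_topology.
Context {R : realType} {E : set (\bar R)}.
Local Notation Ed := (cemetery E).
Implicit Types (e u v z : E) (b : bool) (c : \bar R).

(* Reversing the order of the line exchanges "up" and "down": [dir b] is the
   inclusion of E in the extended reals up to this reversal. *)
Definition dir b e : \bar R := if b then - set_val e else set_val e.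

Lemma dir_continuous b : continuous (dir b).
Proof.
case: b => x; last exact: (@initial_continuous E (\bar R) set_val).
apply: (@continuous_comp E (\bar R) (\bar R) set_val oppe).
  exact: (@initial_continuous E (\bar R) set_val).
exact: oppe_continuous.
Qed.

Lemma dir_inj b : injective (dir b).
Proof.
by case: b => x y /=; [move=> /oppe_inj|]; exact: val_inj.
Qed.

Lemma dir_neg b e : dir (~~ b) e = - dir b e.
Proof. by case: b; rewrite /dir/= ?oppeK. Qed.

Lemma dir_ltN b e z : (dir (~~ b) e < dir (~~ b) z) = (dir b z < dir b e).
Proof. by rewrite !dir_neg lteN2. Qed.

Lemma nbhs_SomeE e (A : set Ed) :
  nbhs (Some e : Ed) A = nbhs e ((@Some E) @^-1` A).
Proof. by []. Qed.

Lemma near_dir_lt b e c : dir b e < c ->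
  \forall q \near (Some e : Ed), exists2 z, q = Some z & dir b z < c.
Proof.
move=> ec; suff : \forall z \near e, dir b z < c.
  by rewrite /prop_near1 nbhs_SomeE; apply: filterS => z zc; exists z.
apply: (@dir_continuous b e [set y | y < c]).
apply: open_nbhs_nbhs; split => //; exact: open_ereal_lt_ereal.
Qed.

Lemma near_dir_gt b e c : c < dir b e ->
  \forall q \near (Some e : Ed), exists2 z, q = Some z & c < dir b z.
Proof.
move=> ec; suff : \forall z \near e, c < dir b z.
  by rewrite /prop_near1 nbhs_SomeE; apply: filterS => z zc; exists z.
apply: (@dir_continuous b e [set y | c < y]).
apply: open_nbhs_nbhs; split => //; exact: open_ereal_gt_ereal.
Qed.

Lemma open_SomeT : open [set q : Ed | q <> None].
Proof.
rewrite openE => -[e|]// _; rewrite /interior nbhs_SomeE.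
by apply: (@filterS _ _ _ setT) => //; exact: filterT.
Qed.

Hypothesis nE : nearly_closed E.

Let seg (z z' : E) : set (\bar R) := [set y | set_val z <= y <= set_val z'].

(** Closing E adds at most its infimum and supremum. If one of them lies in a segment with endpoints
    in E, it is one of these endpoints, hence already in E. *)
Let closed_seg z z' : closed (seg z z' `&` E).
Proof.
have -> : seg z z' `&` E = seg z z' `&` (E `|` [set ereal_inf E; ereal_sup E]).
  apply/seteqP; split => [y [? Ey]|y [/andP[zy yz'] [Ey|]]]; first by split => //; left.
    by split => //; rewrite /seg/= zy.
  have Ez : E (set_val z) by exact: (set_valP z).
  have Ez' : E (set_val z') by exact: (set_valP z').
  move=> [|] ye; (split; first by rewrite /seg/= zy).
    have -> // : y = set_val z.
    by apply/eqP; rewrite eq_le zy andbT ye; apply: ereal_inf_lbound.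
  have -> // : y = set_val z'.
  by apply/eqP; rewrite eq_le yz' ye; apply: ereal_sup_ubound.
apply: closedI => //.
rewrite (_ : seg z z' = ~` [set y | y < set_val z] `&` ~` [set y | set_val z' < y]).
  apply: closedI; apply: open_closedC; [exact: open_ereal_lt_ereal|exact: open_ereal_gt_ereal].
apply/seteqP; split => y; rewrite /seg/= !leNgt.
  by move=> /andP[/negP ? /negP ?].
by move=> [/negP -> /negP ->].
Qed.

(** With neither end in E every point of E is finite, so a segment is a closed part of a compact
    real interval. Closed compact sets are what neighbourhoods of infinity avoid in the one-point
    compactification. *)
Let compact_seg z z' : ~ E (ereal_inf E) -> ~ E (ereal_sup E) ->
  compact [set e : E | seg z z' (set_val e)] /\
  closed [set e : E | seg z z' (set_val e)].
Proof.
move=> nl nr.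
have Ez : E (set_val z) by exact: (set_valP z).
have Ez' : E (set_val z') by exact: (set_valP z').
have fin e : set_val e \is a fin_num.
  have Ee := set_valP e.
  rewrite fin_numE; apply/andP; split; apply/eqP => eoo.
    apply: nl; rewrite (_ : ereal_inf E = set_val e)//; apply/eqP.
    by rewrite eq_le ereal_inf_lbound// eoo leNye.
  apply: nr; rewrite (_ : ereal_sup E = set_val e)//; apply/eqP.
  by rewrite eq_le ereal_sup_ubound// eoo leey.
have clos : closed [set e : E | seg z z' (set_val e)].
  rewrite (_ : mkset _ = set_val @^-1` (seg z z' `&` E)).
    apply: closed_comp => // x _; exact: (@initial_continuous E (\bar R) set_val).
  by apply/seteqP; split => e /=; [split => //; exact: set_valP|case].
split => //.
have cK : compact (seg z z' `&` E).
  apply: (@subclosed_compact _ _ (EFin @` `[fine (set_val z), fine (set_val z')]%classic)) => //.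
    apply: continuous_compact; last exact: segment_compact.
    apply: continuous_subspaceT => x.
    by apply: cvg_EFin; [exact: nearW|exact: cvg_id].
  move=> y [/andP[zy yz'] _]; have fy : y \is a fin_num.
    rewrite fin_real// (lt_le_trans _ zy) ?(le_lt_trans yz')// ?ltey_eq ?ltNye_eq ?fin//.
  exists (fine y); last exact: fineK.
  by rewrite /= in_itv/= -!lee_fin !fineK// zy.
(* Compactness is wanted in the subtype: the filter is pushed to the extended reals by [set_val],
   and a cluster point found there is pulled back through the initial topology. *)
move=> F FF FK.
have [|y [[yz Ey] cy]] := cK (set_val @ F) _.
  rewrite /nbhs/=; apply: filterS FK => e /= se; split => //; exact: set_valP.
exists (exist _ y (mem_set Ey)); split; first by [].
move=> A B FA; rewrite nbhsE/= => -[U [[V oV <-] Ve] UB].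
have [||w [[e Ae ew] Vw]] := cy (set_val @` A) V.
- by rewrite /nbhs/=; apply: filterS FA => e Ae; exists e.
- by apply: open_nbhs_nbhs; split.
by exists e; split => //; apply: UB; rewrite /preimage/= ew.
Qed.

(** One case per form of the cemetery: isolated, it has no neighbours in E; identified with an end,
    it is separated from the segment by one of the endpoints; at infinity, the segment is compact.
    All later use of the topology at the cemetery passes through this fact. *)
Lemma near_cemetery b z z' : \forall q \near (None : Ed),
  forall e, q = Some e -> ~ (dir b z <= dir b e <= dir b z').
Proof.
wlog -> : b z z' / b = false.
  move=> H; case: b; last exact: H.
  have := H false z' z erefl; apply: filterS => q Hq e /Hq.
  by rewrite /dir !leeN2 andbC.
have Ez : E (set_val z) by exact: (set_valP z).
have Ez' : E (set_val z') by exact: (set_valP z').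
rewrite /dir /prop_near1 /nbhs/=.
case: pselect => l; case: pselect => r //=.
- split => //; rewrite /prop_near1.
  have : \forall y \near ereal_sup E, set_val z' < y.
    apply: open_nbhs_nbhs; split; first exact: open_ereal_gt_ereal.
    rewrite /= lt_neqAle; apply/andP; split; last exact: ereal_sup_ubound.
    by apply/eqP => zE; apply: r; rewrite -zE.
  apply: filterS => y zy e ey _ [<-]; rewrite ey => /andP[_].
  by rewrite leNgt zy.
- split => //; rewrite /prop_near1.
  have : \forall y \near ereal_inf E, y < set_val z.
    apply: open_nbhs_nbhs; split; first exact: open_ereal_lt_ereal.
    rewrite /= lt_neqAle; apply/andP; split; last exact: ereal_inf_lbound.
    by apply/eqP => zE; apply: l; rewrite zE.
  apply: filterS => y zy e ey _ [<-]; rewrite ey => /andP[].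
  by rewrite leNgt zy.
- have [cs cl] := compact_seg z z' l r.
  exists [set e : E | seg z z' (set_val e)] => //.
  by move=> q [[e /= ne <-]|->//] _ [<-].
Qed.

(** If nothing in E lies strictly below [e] in direction [b], then [e] itself serves as the
    bound. *)
Lemma near_dir_ge b e : exists z,
  \forall q \near (Some e : Ed), exists2 v, q = Some v & dir b z <= dir b v.
Proof.
have [[z ze]|nz] := pselect (exists z, dir b z < dir b e).
  by exists z; apply: filterS (near_dir_gt ze) => q [v -> /ltW]; exists v.
exists e; have H : nbhs (Some e : Ed) [set q : Ed | q <> None].
  by apply: open_nbhs_nbhs; split; [exact: open_SomeT|].
apply: filterS H => -[v|]// _; exists v => //.
by rewrite leNgt; apply/negP => ve; apply: nz; exists v.
Qed.

Lemma near_segment b e : exists z z', \forall q \near (Some e : Ed),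
  exists2 v, q = Some v & dir b z <= dir b v <= dir b z'.
Proof.
have [z Hz] := near_dir_ge b e; have [z' Hz'] := near_dir_ge (~~ b) e.
exists z, z'; apply: filterS2 Hz Hz' => q [v -> zv] [_ [<-]].
by rewrite !dir_neg leeN2 => vz'; exists v => //; rewrite zv.
Qed.

(** A limit in E confines the values to a segment, which the neighbours of the cemetery avoid; two
    limits in E are separated by a rational. *)
Lemma cemetery_limit_unique T (F : set_system T) (FF : ProperFilter F)
  (f : T -> Ed) (p q : Ed) : f @ F --> p -> f @ F --> q -> p = q.
Proof.
have NS e : f @ F --> (Some e : Ed) -> f @ F --> (None : Ed) -> False.
  move=> fe fN.
  have [z [z' /fe H]] := near_segment false e.
  have /fN H' := near_cemetery false z z'.
  have [t [[v -> vz] /(_ _ erefl)]] := filter_ex (filterI H H').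
  by rewrite vz; exact.
case: p q => [e|] [u|] // fp fq; [|by case: (NS e)|by case: (NS u)].
congr Some; apply: (@dir_inj false); apply: contrapT => /eqP.
rewrite neq_lt => /orP[] /ereal_rat_dense[r er ru].
  have [t [/= [v -> vr] [_ [<-]]]] :=
    filter_ex (filterI (fp _ (near_dir_lt er)) (fq _ (near_dir_gt ru))).
  by rewrite ltNge ltW.
have [t [/= [v -> vr] [_ [<-]]]] :=
  filter_ex (filterI (fq _ (near_dir_lt er)) (fp _ (near_dir_gt ru))).
by rewrite ltNge ltW.
Qed.

End cemetery_topology.

(** * Entrance times of a path *)

Section entrance_times.
Context {R : realType} {E : set (\bar R)}.
Local Notation Ed := (cemetery E).
Implicit Types (e u v z : E) (b : bool) (c : \bar R) (p : R -> Ed) (s t : R).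

(** Absorption is asserted from positive times only, because the lifetime is an infimum over t > 0:
    a path at the cemetery at time 0 may still come alive later, and such paths are only known to
    form a null set. *)
Record regular_path p : Prop := {
  path_absorbed : forall s t, (0 < s)%R -> (s <= t)%R -> p s = None -> p t = None ;
  path_right : forall t, (0 <= t)%R -> p s @[s --> t^'+] --> p t ;
  path_left : forall t, (0 < t)%R -> exists q : Ed, p s @[s --> t^'-] --> q
}.

(* Paths issued from the cemetery are given the junk value -oo, so that the
   level sets of [runsup] are measurable without discarding a null set. *)
Definition runsup b p t : \bar R :=
  ereal_sup [set y | p 0%R <> None /\
    exists s e, [/\ (0 <= s <= t)%R, p s = Some e & y = dir b e]].

(* Left limits are taken into account through the supremum: [entrance b p c] is
   the first time t such that [dir b (X_t)] or [dir b (X_{t-})] is at least c. *)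
Definition entrance b p c : \bar R :=
  ereal_inf [set t%:E | t in [set t | (0 <= t)%R /\ c <= runsup b p t]].

Lemma runsup_ge b p s t e : p 0%R <> None -> (0 <= s <= t)%R -> p s = Some e ->
  dir b e <= runsup b p t.
Proof. by move=> p0 st pse; apply: ereal_sup_ubound; split => //; exists s, e. Qed.

Lemma runsup_le b p t c :
  (forall s e, (0 <= s <= t)%R -> p s = Some e -> dir b e <= c) ->
  runsup b p t <= c.
Proof. by move=> h; apply: ge_ereal_sup => _ [_ [s [e [st pse ->]]]]; exact: h pse. Qed.

Lemma runsup_gt b p t c : c < runsup b p t ->
  p 0%R <> None /\ exists s e, [/\ (0 <= s <= t)%R, p s = Some e & c < dir b e].
Proof.
by move=> /ereal_sup_gt[_ [p0 [s [e [st pse ->]]]] ce]; split => //; exists s, e.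
Qed.

Lemma runsup_nd b p s t : (s <= t)%R -> runsup b p s <= runsup b p t.
Proof.
move=> st; apply: ereal_sup_le => _ [p0 [r [e [/andP[r0 rs] pr ->]]]].
by split => //; exists r, e; rewrite r0 (le_trans rs).
Qed.

Lemma runsup0 b p e : p 0%R = Some e -> runsup b p 0 = dir b e.
Proof.
move=> p0; apply/eqP; rewrite eq_le; apply/andP; split.
  by apply: runsup_le => s u; rewrite -eq_le => /eqP <-; rewrite p0 => -[->].
by apply: (@runsup_ge _ _ 0); rewrite ?p0 ?lexx.
Qed.

Lemma eq_entrance b p p' c : (forall s, (0 <= s)%R -> p s = p' s) ->
  entrance b p c = entrance b p' c.
Proof.
move=> pp'; have runsupE t : runsup b p t = runsup b p' t.
  rewrite /runsup; congr ereal_sup; apply/seteqP; split => z [p0 [s [e [/andP[s0 st] ps ->]]]].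
    by split; [rewrite -pp'|exists s, e; rewrite s0 st -pp'].
  by split; [rewrite pp'|exists s, e; rewrite s0 st pp'].
rewrite /entrance; congr ereal_inf; congr image; apply/seteqP.
by split => t /=; rewrite runsupE.
Qed.

Lemma runsup_right_lt b p t c : regular_path p -> (0 <= t)%R -> runsup b p t < c ->
  exists2 s, (t < s)%R & runsup b p s < c.
Proof.
move=> pP t0 tc; have [x tx xc] := ereal_rat_dense tc.
suff [s ts sx] : exists2 s, (t < s)%R &
    forall r e, (t < r <= s)%R -> p 0%R <> None -> p r = Some e -> dir b e <= (ratr x)%:E.
  exists s => //; apply: le_lt_trans xc; apply: ge_ereal_sup.
  move=> _ [p0 [r [e [/andP[r0 rs] pr ->]]]].
  have [rt|tr] := leP r t; last by apply: sx pr => //; rewrite tr.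
  by apply: le_trans (ltW tx); apply: runsup_ge pr => //; rewrite r0.
have [p0|p0] := pselect (p 0%R = None); first by exists (t + 1)%R => //; rewrite ltrDl.
case pt : (p t) => [e|]; last first.
  exists (t + 1)%R; rewrite ?ltrDl// => r e /andP[tr _] _.
  rewrite (path_absorbed pP _ (ltW tr) pt)// lt_neqAle t0 andbT.
  by apply/eqP => t00; apply: p0; rewrite t00.
have et : dir b e < (ratr x)%:E.
  by apply: le_lt_trans tx; apply: runsup_ge pt => //; rewrite t0 lexx.
have := path_right pP t0; rewrite pt => /(_ _ (near_dir_lt et)).
move=> -[d /= d0 dP].
exists (t + d / 2)%R; first by rewrite ltrDl divr_gt0.
move=> r u /andP[tr rd] _ pr.
have [|//|v] := dP r.
  rewrite /= distrC ger0_norm ?subr_ge0 ?(ltW tr)// ltrBlDl.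
  by rewrite (le_lt_trans rd)// ltrD2l ltr_pdivrMr// ltr_pMr// ltr1n.
by rewrite pr => -[->] /ltW.
Qed.

Lemma entrance_ge0 b p c : 0 <= entrance b p c.
Proof. by apply: le_ereal_inf_tmp => _ [t [t0 _] <-]; rewrite lee_fin. Qed.

(** Right-continuity of the path makes the infimum attained, so the event on the left is decided by
    the path up to time t. *)
Lemma entrance_le b p c t : regular_path p -> (0 <= t)%R ->
  (entrance b p c <= t%:E) = (c <= runsup b p t).
Proof.
move=> pP t0; apply/idP/idP => [Dt|ct].
  rewrite leNgt; apply/negP => /(runsup_right_lt pP t0)[s ts sc].
  move: Dt; rewrite leNgt => /negP; apply.
  apply: (@lt_le_trans _ _ s%:E); first by rewrite lte_fin.
  apply: le_ereal_inf_tmp => _ [r [r0 cr] <-]; rewrite lee_fin leNgt.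
  by apply/negP => rs; move: sc; rewrite ltNge (le_trans cr)// runsup_nd// ltW.
by apply: ereal_inf_lbound; exists t.
Qed.

Lemma entrance_gt b p c t : regular_path p -> (0 <= t)%R ->
  (t%:E < entrance b p c) = (runsup b p t < c).
Proof. by move=> pP t0; rewrite !ltNge entrance_le. Qed.

Lemma entrance_nd b p c c' : c <= c' -> entrance b p c <= entrance b p c'.
Proof.
move=> cc'; apply: ereal_inf_le_tmp => _ [t [t0 ct] <-].
by exists t => //; split => //; exact: le_trans ct.
Qed.

Lemma entrance_fin b p c : entrance b p c < +oo -> exists2 t, (0 <= t)%R & entrance b p c = t%:E.
Proof.
move=> Doo; exists (fine (entrance b p c)); rewrite ?fine_ge0 ?entrance_ge0//.
by rewrite fineK// ge0_fin_numE// entrance_ge0.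
Qed.

(** At the limit of these times the running supremum is at least every [below c n], hence at least
    [c]. *)
Lemma entrance_cvg b p c : regular_path p ->
  entrance b p (below c n) @[n --> \oo] --> entrance b p c.
Proof.
move=> pP.
have nd : nondecreasing_seq (fun n => entrance b p (below c n)).
  by move=> m n mn; apply: entrance_nd; exact: below_nd.
rewrite (_ : entrance b p c = ereal_sup (range (fun n => entrance b p (below c n)))).
  exact: ereal_nondecreasing_cvgn.
have le : forall n, below c n <= c.
  move=> n; have [->//|cN] := eqVneq c -oo.
  by apply: ltW; apply: below_lt; rewrite ltNye.
apply/eqP; rewrite eq_le; apply/andP; split; last first.
  by apply: ge_ereal_sup => _ [n _ <-]; apply: entrance_nd.
rewrite leNgt; apply/negP => supD.
have ub n : entrance b p (below c n) <= ereal_sup (range (fun n => entrance b p (below c n))).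
  by apply: ereal_sup_ubound; exists n.
move: supD ub; set T := ereal_sup _ => TD ub.
have Tfin : T \is a fin_num.
  rewrite ge0_fin_numE; last exact: le_trans (entrance_ge0 _ _ _) (ub 0%N).
  by rewrite (lt_le_trans TD)// leey.
have T0 : (0 <= fine T)%R by rewrite fine_ge0// (le_trans _ (ub 0%N))// entrance_ge0.
move: TD; rewrite -(fineK Tfin) entrance_gt// ltNge => /negP; apply.
by apply: below_le => n; rewrite -entrance_le// fineK.
Qed.

Lemma runsup_shift b p t s : p 0%R <> None -> p t <> None -> (0 <= t)%R -> (0 <= s)%R ->
  runsup b p (s + t) = maxe (runsup b p t) (runsup b (fun r => p (r + t)%R) s).
Proof.
move=> p0 pt t0 s0; apply/eqP; rewrite eq_le; apply/andP; split.
  apply: runsup_le => r e /andP[r0 rts] pr; rewrite le_max.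
  have [rt|tr] := leP r t.
    by apply/orP; left; apply: runsup_ge pr => //; rewrite r0.
  apply/orP; right; apply: (@runsup_ge _ _ (r - t)) => /=.
  - by rewrite add0r.
  - by rewrite subr_ge0 (ltW tr)/= lerBlDr.
  - by rewrite subrK.
rewrite ge_max runsup_nd ?lerDr//=; apply: runsup_le => r e /andP[r0 rs] pr.
by apply: runsup_ge pr => //; rewrite addr_ge0//= lerD2r.
Qed.

Lemma regular_shift p t : regular_path p -> (0 <= t)%R ->
  regular_path (fun r => p (r + t)%R).
Proof.
move=> pP t0; split.
- move=> r s r0 rs; apply: (path_absorbed pP); first by rewrite ltr_wpDr.
  by rewrite lerD2r.
- move=> r r0.
  apply: (@cvg_comp _ _ _ (fun s => (s + t)%R) p _ ((r + t)%R^'+)).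
    move=> A [d /= d0 dA].
    exists d => //= s rs rs'; apply: dA; rewrite /= ?ltrD2r//.
    by rewrite opprD addrACA subrr addr0.
  exact: (path_right pP (addr_ge0 r0 t0)).
- move=> r r0; have [q pq] := path_left pP (ltr_wpDr t0 r0).
  exists q; apply: (@cvg_comp _ _ _ (fun s => (s + t)%R) p _ ((r + t)%R^'-)) => //.
  move=> A [d /= d0 dA].
  exists d => //= s rs rs'; apply: dA; rewrite /= ?ltrD2r//.
  by rewrite opprD addrACA subrr addr0.
Qed.

Lemma entrance_shift b p t c : regular_path p -> p 0%R <> None -> p t <> None ->
  (0 <= t)%R -> runsup b p t < c ->
  entrance b p c = entrance b (fun r => p (r + t)%R) c + t%:E.
Proof.
move=> pP p0 pt t0 tc.
apply/eqP; rewrite eq_le; apply/andP; split.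
  rewrite -leeBlDr//; apply: le_ereal_inf_tmp => _ [s [s0 cs] <-].
  rewrite leeBlDr// -EFinD entrance_le// ?addr_ge0// runsup_shift//.
  by rewrite le_max cs orbT.
apply: le_ereal_inf_tmp => _ [s [s0 cs] <-].
have ts : (t <= s)%R.
  by rewrite leNgt; apply/negP => st; move: tc; rewrite ltNge (le_trans cs)// runsup_nd// ltW.
have st0 : (0 <= s - t)%R by rewrite subr_ge0.
rewrite -leeBrDr// -EFinB entrance_le//; last exact: regular_shift.
move: cs; rewrite -[X in runsup _ _ X](subrK t s) runsup_shift// le_max => /orP[|//].
by move=> ct; move: tc; rewrite ltNge ct.
Qed.

End entrance_times.

(** * Value of a skip-free path at an entrance time *)

Section skip_free_paths.
Context {R : realType} {E : set (\bar R)}.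
Local Notation Ed := (cemetery E).
Implicit Types (e u v x y z : E) (b : bool) (c : \bar R) (X : \bar R -> Ed) (s t : R).

Let fpath X : R -> Ed := fun t => X t%:E.

(** The dichotomy at an entrance time: either the level is approached before t, and the entrance
    times of lower levels announce t, or it is passed by a jump at t. *)
Definition climbs b (p : R -> Ed) t c :=
  forall c', c' < c -> exists2 s, (0 <= s < t)%R & c' <= runsup b p s.

(** The conclusion of quasi-left-continuity for these times, stated for one path: the arguments of
    this section are then deterministic. *)
Definition left_continuous_at_entrance b X c :=
  entrance b (fpath X) c < +oo ->
  X (entrance b (fpath X) (below c n)) @[n --> \oo] --> X (entrance b (fpath X) c).

Definition adjacent_jumps (p : R -> Ed) := forall t u v, (0 < t)%R ->
  p s @[s --> t^'-] --> (Some u : Ed) -> p t = Some v ->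
  forall b z, ~ (dir b u < dir b z < dir b v).

Hypothesis nE : nearly_closed E.

(** The entrance times of lower levels are strictly less than t and tend to t, so the path along
    them tends both to its left limit and, by quasi-left-continuity, to its value at t. *)
Lemma climbs_left_limit b X t c q : regular_path (fpath X) -> -oo < c ->
  left_continuous_at_entrance b X c -> entrance b (fpath X) c = t%:E ->
  (0 < t)%R -> fpath X s @[s --> t^'-] --> q ->
  climbs b (fpath X) t c -> fpath X t = q.
Proof.
move=> pP cN lX Dt t0 pq cl.
have D_lt n : entrance b (fpath X) (below c n) < t%:E.
  have [s /andP[s0 st] cs] := cl _ (below_lt n cN).
  by rewrite (@le_lt_trans _ _ s%:E) ?lte_fin// entrance_le.
pose D n := fine (entrance b (fpath X) (below c n)).
have DE n : entrance b (fpath X) (below c n) = (D n)%:E.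
  rewrite fineK// ge0_fin_numE ?entrance_ge0//.
  by rewrite (lt_trans (D_lt n))// ltry.
have D_lt' n : (D n < t)%R by rewrite -lte_fin -DE.
have Dcvg : D n @[n --> \oo] --> t^'-.
  have := @entrance_cvg _ _ b _ c pP; rewrite Dt => /fine_cvg Dcvg A At.
  have {Dcvg}Dcvg : D n @[n --> \oo] --> t := Dcvg.
  have /Dcvg H : nbhs t [set x | (x < t)%R -> A x] := At.
  have {}H : \forall n \near \oo, (D n < t)%R -> A (D n) := H.
  suff : \forall n \near \oo, A (D n) by [].
  by apply: filterS H => n; apply; exact: D_lt'.
have pD : fpath X (D n) @[n --> \oo] --> q.
  exact: (@cvg_comp _ _ _ D (fpath X) \oo t^'- _ Dcvg pq).
have := lX; rewrite /left_continuous_at_entrance Dt ltry => /(_ isT).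
under eq_fun do rewrite DE.
by move=> /(cemetery_limit_unique nE); apply.
Qed.

Lemma not_climbs b (p : R -> Ed) t c c' : (0 < t)%R -> c' < c ->
  (forall s, (0 <= s < t)%R -> runsup b p s < c) ->
  (\forall s \near t^'-, forall e, p s = Some e -> dir b e <= c') ->
  ~ climbs b p t c.
Proof.
move=> t0 c'c pc [d /= d0 dp] cl.
(* Up to [r] the supremum is below [c], and after [r] the values are at most [c']: the supremum over
   [0,t[ is bounded away from [c]. *)
pose r := Num.max 0%R (t - d / 2)%R.
have r0 : (0 <= r)%R by rewrite le_max lexx.
have d2 : (0 < d / 2)%R by rewrite divr_gt0.
have rt : (r < t)%R by rewrite gt_max t0 gtrDl oppr_lt0.
have rc : runsup b p r < c by apply: pc; rewrite r0.
have /ereal_rat_dense[q mq qc] : maxe (runsup b p r) c' < c by rewrite gt_max rc.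
have [s /andP[s0 st] qs] := cl _ qc.
have /(lt_le_trans mq) : (ratr q)%:E <= runsup b p s by [].
rewrite ltNge => /negP; apply.
clear q mq qc qs.
have [p0|p0] := pselect (p 0%R = None).
  by apply: ge_ereal_sup => y [/(_ p0)].
apply: runsup_le => s' e /andP[s'0 s's] ps'; rewrite le_max.
have [s'r|rs'] := leP s' r.
  by apply/orP; left; apply: runsup_ge ps' => //; rewrite s'0.
apply/orP; right; apply: dp ps'.
  rewrite /= ger0_norm ?subr_ge0 ?(le_trans s's (ltW st))//.
  rewrite ltrBlDl -ltrBlDr; apply: le_lt_trans rs'; rewrite le_max; apply/orP; right.
  by rewrite lerD2l lerN2 ler_pdivrMr// ler_pMr// ler1n.
exact: le_lt_trans st.
Qed.

Lemma climbs_left_limit_ge b (p : R -> Ed) t c u : (0 < t)%R ->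
  (forall s, (0 <= s < t)%R -> runsup b p s < c) ->
  p s @[s --> t^'-] --> (Some u : Ed) -> climbs b p t c -> c <= dir b u.
Proof.
move=> t0 pc pu cl; rewrite leNgt; apply/negP => /ereal_rat_dense[q uq qc].
apply: (not_climbs t0 qc pc _ cl).
have H : \forall s \near t^'-, exists2 z, p s = Some z & dir b z < (ratr q)%:E.
  exact: pu _ (near_dir_lt uq).
by apply: filterS H => s [z -> zq] _ [<-]; exact: ltW.
Qed.

Lemma left_limit_dir_le b (p : R -> Ed) t c u : (0 < t)%R ->
  (forall s e, (0 <= s < t)%R -> p s = Some e -> dir b e <= c) ->
  p s @[s --> t^'-] --> (Some u : Ed) -> dir b u <= c.
Proof.
move=> t0 pc pu; rewrite leNgt; apply/negP => cu.
have {}cu : \forall s \near t^'-, exists2 e, p s = Some e & c < dir b e.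
  exact: pu _ (near_dir_gt cu).
near t^'- => s.
have [e pse ce] : exists2 e, p s = Some e & c < dir b e by near: s.
have s0 : (0 < s)%R by near: s; exact: nbhs_left_gt.
have st : (s < t)%R by near: s; exact: nbhs_left_lt.
by move: ce; rewrite ltNge (pc s)// (ltW s0).
Unshelve. all: by end_near. Qed.

Let dirsup b := ereal_sup (range (@dir R E b)).

(* If the left limit is the cemetery while the path stays above [dir b y], then
   it escapes at the upper end of E, where quasi-left-continuity kills it. *)
Lemma no_return_from_cemetery b X t x y v : regular_path (fpath X) ->
  left_continuous_at_entrance b X (dirsup b) ->
  X 0 = Some x -> (0 < t)%R ->
  (forall s e, (0 <= s < t)%R -> X s%:E = Some e -> dir b y < dir b e) ->
  fpath X s @[s --> t^'-] --> (None : Ed) -> X t%:E = Some v -> False.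
Proof.
move=> pP lX X0 t0 yX XN Xv.
have p0 : fpath X 0 <> None by rewrite /fpath X0.
have alive s : (0 < s <= t)%R -> exists e, X s%:E = Some e.
  move=> /andP[s0 st]; case Xs : (X s%:E) => [e|]; first by exists e.
  by have := path_absorbed pP s0 st Xs; rewrite /fpath Xv.
(* Near the cemetery the path avoids the segment from y to z; staying above y, it must be above
   z. *)
have escape z : \forall s \near t^'-, exists2 e, X s%:E = Some e & dir b z < dir b e.
  have H : \forall s \near t^'-, forall e, X s%:E = Some e ->
      ~ (dir b y <= dir b e <= dir b z).
    exact: XN _ (near_cemetery nE b y z).
  near=> s.
  have s0 : (0 < s)%R by near: s; exact: nbhs_left_gt.
  have st : (s < t)%R by near: s; exact: nbhs_left_lt.
  have [|e Xs] := alive s; first by rewrite s0 ltW.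
  exists e => //; rewrite ltNge; apply/negP => ez.
  have : forall e, X s%:E = Some e -> ~ (dir b y <= dir b e <= dir b z) by near: s.
  by move=> /(_ _ Xs); rewrite ez (ltW (yX _ _ _ Xs)) ?(ltW s0)//; exact.
have dir_lt z : dir b z < dirsup b.
  near t^'- => s.
  have [e _ ze] : exists2 e, X s%:E = Some e & dir b z < dir b e.
    by near: s; exact: escape.
  by apply: (lt_le_trans ze); apply: ereal_sup_ubound; exists e.
have runsup_t : dirsup b <= runsup b (fpath X) t.
  apply: ge_ereal_sup => _ [z _ <-].
  near t^'- => s.
  have [e Xs ze] : exists2 e, X s%:E = Some e & dir b z < dir b e.
    by near: s; exact: escape.
  have s0 : (0 < s)%R by near: s; exact: nbhs_left_gt.
  have st : (s < t)%R by near: s; exact: nbhs_left_lt.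
  apply: (le_trans (ltW ze)); apply: runsup_ge Xs => //.
  by rewrite (ltW s0) ltW.
have Dt : entrance b (fpath X) (dirsup b) <= t%:E by rewrite entrance_le// ltW.
have /entrance_fin[r r0 Dr] : entrance b (fpath X) (dirsup b) < +oo.
  by rewrite (le_lt_trans Dt)// ltry.
have rt : (r <= t)%R by rewrite -lee_fin -Dr.
have rpos : (0 < r)%R.
  rewrite lt_neqAle r0 andbT; apply/eqP => r00.
  have : entrance b (fpath X) (dirsup b) <= 0%R%:E by rewrite Dr -r00.
  by rewrite entrance_le// (runsup0 b X0) leNgt dir_lt.
have rc s : (0 <= s < r)%R -> runsup b (fpath X) s < dirsup b.
  by move=> /andP[s0 sr]; rewrite -entrance_gt// Dr lte_fin.
have cl : climbs b (fpath X) r (dirsup b).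
  have rr : dirsup b <= runsup b (fpath X) r by rewrite -entrance_le// Dr.
  move=> c' c'c.
  (* With [m] at least the value at r, a time at which the path exceeds [m] cannot be r. *)
  pose m := if X r%:E is Some e then maxe c' (dir b e) else c'.
  have mc : m < dirsup b by rewrite /m; case: (X r%:E) => [e|]//; rewrite gt_max c'c dir_lt.
  have [_ [s [e [/andP[s0 sr] Xs me]]]] := runsup_gt (lt_le_trans mc rr).
  have sr' : (s < r)%R.
    rewrite lt_neqAle sr andbT; apply/eqP => sr'; move: me; rewrite /m -sr' -/(fpath X s) Xs.
    by rewrite gt_max ltxx andbF.
  exists s; first by rewrite s0.
  apply: le_trans (runsup_ge b p0 _ Xs); last by rewrite s0 lexx.
  apply: le_trans (ltW me); rewrite /m; case: (X r%:E) => [e'|]//.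
  by rewrite le_max lexx.
have [q Xq] := path_left pP rpos.
have Xr := climbs_left_limit pP (le_lt_trans (leNye _) (dir_lt x)) lX Dr rpos Xq cl.
(* The value at r is the left limit [q]. A point of E would have to reach the upper end, which every
   point of E is strictly below; the cemetery would have absorbed the path by time t. *)
case: q => [u|] in Xq Xr.
  by have := climbs_left_limit_ge rpos rc Xq cl; rewrite leNgt dir_lt.
by have := path_absorbed pP rpos rt Xr; rewrite /fpath Xv.
Unshelve. all: by end_near. Qed.

Lemma value_at_entrance b X t x y : regular_path (fpath X) ->
  adjacent_jumps (fpath X) ->
  left_continuous_at_entrance b X (dir b y) ->
  left_continuous_at_entrance (~~ b) X (dirsup (~~ b)) ->
  X 0 = Some x -> dir b x < dir b y -> entrance b (fpath X) (dir b y) = t%:E ->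
  (0 < t)%R /\ X t%:E = Some y.
Proof.
move=> pP sf lX lX' X0 xy Dt.
have p0 : fpath X 0 <> None by rewrite /fpath X0.
have t0 : (0 <= t)%R by rewrite -lee_fin -Dt entrance_ge0.
have tpos : (0 < t)%R.
  rewrite lt_neqAle t0 andbT; apply/eqP => t00.
  have : entrance b (fpath X) (dir b y) <= 0%R%:E by rewrite Dt -t00.
  by rewrite entrance_le// (runsup0 b X0) leNgt xy.
split => //.
have tc s : (0 <= s < t)%R -> runsup b (fpath X) s < dir b y.
  by move=> /andP[s0 st]; rewrite -entrance_gt// Dt lte_fin.
have Xlt s e : (0 <= s < t)%R -> X s%:E = Some e -> dir b e < dir b y.
  move=> st Xs; apply: le_lt_trans (tc _ st); apply: runsup_ge Xs => //.
  by case/andP: st => ->; rewrite lexx.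
have rt : dir b y <= runsup b (fpath X) t by rewrite -entrance_le// Dt.
have [q Xq] := path_left pP tpos.
have [cl|] := pselect (climbs b (fpath X) t (dir b y)).
  have Xt : X t%:E = q := climbs_left_limit pP (le_lt_trans (leNye _) xy) lX Dt tpos Xq cl.
  case: q => [u|] in Xq Xt.
    rewrite Xt; congr Some; apply: (@dir_inj _ _ b); apply/eqP; rewrite eq_le.
    rewrite (climbs_left_limit_ge tpos tc Xq cl) andbT.
    by apply: left_limit_dir_le tpos _ Xq => s e st /(Xlt _ _ st)/ltW.
  (* If the left limit is the cemetery, the path near t avoids the segment from x to y; being below
     y, it stays below x and does not climb to y. *)
  exfalso; apply: (not_climbs tpos xy tc _ cl).
  have H : \forall s \near t^'-, forall e, X s%:E = Some e ->
      ~ (dir b x <= dir b e <= dir b y).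
    exact: Xq _ (near_cemetery nE b x y).
  near=> s => e Xs; rewrite leNgt; apply/negP => xe.
  have : forall e, X s%:E = Some e -> ~ (dir b x <= dir b e <= dir b y) by near: s.
  move=> /(_ _ Xs); apply; rewrite (ltW xe)/= ltW//; apply: Xlt Xs; apply/andP; split.
    by apply: ltW; near: s; exact: nbhs_left_gt.
  by near: s; exact: nbhs_left_lt.
(* Without climbing, the values before t stay under some [c'] below y, and the value at t is at
   least y. If the left limit is in E, the jump passes over no point of E and so lands on y. *)
move=> /existsNP[c' /not_implyP[c'c /forall2NP ncl]].
have {}ncl s : (0 <= s < t)%R -> runsup b (fpath X) s <= c'.
  by move=> st; case: (ncl s) => // /negP; rewrite -ltNge => /ltW.
have [v Xv yv] : exists2 v, X t%:E = Some v & dir b y <= dir b v.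
  have [_ [s [e [/andP[s0 st] Xs c'e]]]] := runsup_gt (lt_le_trans c'c rt).
  have st' : s = t.
    apply/eqP; rewrite eq_le st leNgt; apply/negP => st'.
    move: c'e; rewrite ltNge => /negP; apply.
    apply: le_trans (ncl s _); last by rewrite s0.
    by apply: runsup_ge Xs => //; rewrite s0 lexx.
  exists e; first by rewrite -st'.
  rewrite leNgt; apply/negP => ey.
  move: rt; rewrite leNgt => /negP; apply.
  apply: (@le_lt_trans _ _ (maxe c' (dir b e))); last by rewrite gt_max c'c.
  apply: runsup_le => s' e' /andP[s'0 s't] Xs'; rewrite le_max.
  move: s't; rewrite le_eqVlt => /orP[/eqP s't|s't].
    by move: Xs'; rewrite s't -st' Xs => -[->]; rewrite lexx orbT.
  rewrite (le_trans _ (ncl s' _)) ?s'0//.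
  by apply: runsup_ge Xs' => //; rewrite s'0 lexx.
case: q => [u|] in Xq.
  have uc' : dir b u <= c'.
    apply: left_limit_dir_le tpos _ Xq => s e st Xs; apply: le_trans (ncl _ st).
    by apply: runsup_ge Xs => //; case/andP: st => ->; rewrite lexx.
  have := sf _ _ _ tpos Xq Xv b y => /negP; rewrite (le_lt_trans uc' c'c)/= -leNgt => vy.
  by rewrite Xv; congr Some; apply: (@dir_inj _ _ b); apply/eqP; rewrite eq_le vy.
(* A path that tends to the cemetery while staying below y escapes at the lower end; in the reversed
   direction this is the case already excluded. *)
exfalso; apply: (no_return_from_cemetery pP lX' X0 tpos _ Xq Xv) => s e st /(Xlt _ _ st).
by rewrite dir_ltN; exact.
Unshelve. all: by end_near. Qed.

End skip_free_paths.

(** * Measurability *)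

Section sigma_algebra_predicates.
Context {T : Type} (M : set (set T)) (sM : sigma_algebra setT M).
Implicit Types (A B : set T).

Let M0 : M set0. Proof. by case: sM. Qed.

Lemma sigma_not A : M A -> M [set w | ~ A w].
Proof. by case: sM => _ sC _ /sC; rewrite setTD. Qed.

Lemma sigma_const (Q : Prop) : M [set _ | Q].
Proof.
have [q|nq] := pselect Q.
  rewrite (_ : mkset _ = [set w | ~ (@set0 T) w]); first exact: sigma_not.
  by apply/seteqP; split => w //= _.
by rewrite (_ : mkset _ = set0)//; apply/seteqP; split.
Qed.

Lemma sigma_exists (I : countType) (A : I -> set T) : (forall i, M (A i)) ->
  M [set w | exists i, A i w].
Proof.
move=> MA; pose F n := if unpickle n is Some i then A i else set0.
have -> : [set w | exists i, A i w] = \bigcup_n F n.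
  apply/seteqP; split => [w [i Ai]|w [n _]].
    by exists (pickle i) => //; rewrite /F pickleK.
  by rewrite /F; case: unpickle => // i Ai; exists i.
by case: sM => _ _; apply => n; rewrite /F; case: unpickle.
Qed.

Lemma sigma_or A B : M A -> M B -> M [set w | A w \/ B w].
Proof.
move=> MA MB; rewrite (_ : mkset _ = [set w | exists b : bool, (if b then A else B) w]).
  by apply: sigma_exists => -[].
apply/seteqP; split => [w [Aw|Bw]|w [[] ?]]; [by exists true|by exists false|by left|by right].
Qed.

Lemma sigma_and A B : M A -> M B -> M [set w | A w /\ B w].
Proof.
move=> MA MB; rewrite (_ : mkset _ = [set w | ~ (~ A w \/ ~ B w)]).
  by apply/sigma_not/sigma_or; exact: sigma_not.
by apply/seteqP; split => w /=; rewrite not_orE !notK.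
Qed.

Lemma sigma_imply A B : M A -> M B -> M [set w | A w -> B w].
Proof.
move=> MA MB; rewrite (_ : mkset _ = [set w | ~ A w \/ B w]).
  by apply: sigma_or => //; exact: sigma_not.
apply/seteqP; split => w /=; first by have [Aw /(_ Aw)|] := pselect (A w); [right|left].
by move=> [nA /nA|].
Qed.

Lemma sigma_forall (I : countType) (A : I -> set T) : (forall i, M (A i)) ->
  M [set w | forall i, A i w].
Proof.
move=> MA; rewrite (_ : mkset _ = [set w | ~ (exists i, ~ A i w)]).
  by apply/sigma_not/sigma_exists => i; exact: sigma_not.
by apply/seteqP; split => w /=; [move=> h [i]; exact|rewrite -forallNP => h i; exact: contrapT (h i)].
Qed.

(** Meant for a sigma-algebra containing null sets: [N] has full measure, the last premise concerns
    a null set, and B inherits its membership from A. *)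
Lemma sigma_iff A B N : M A -> M N -> (forall w, N w -> (A w <-> B w)) ->
  M [set w | ~ N w /\ B w] -> M B.
Proof.
move=> MA MN AB MB; rewrite (_ : B = [set w | (N w /\ A w) \/ (~ N w /\ B w)]).
  by apply: sigma_or => //; exact: sigma_and.
apply/seteqP; split => w /=; last by move=> [[Nw /AB]|[]]//; exact.
by have [Nw|Nw] := pselect (N w); [move=> /AB; left; split; auto|right].
Qed.

End sigma_algebra_predicates.

Lemma measurable_sigma_algebra d (T : measurableType d) :
  sigma_algebra setT (@measurable d T).
Proof.
split; [exact: measurable0|by move=> A mA; apply: measurableD|].
by move=> A mA; exact: bigcupT_measurable.
Qed.

(** * Completed measures *)

Section completed_measure.
Context d (T : measurableType d) (R : realType) (mu : {measure set T -> \bar R}).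
Local Notation cmu := (@completed_measure_extension _ _ _ mu).
Local Notation cT := (caratheodory_type (mu^*)%mu).

Lemma completed_measureE (A : set T) : measurable A -> cmu A = mu A.
Proof. exact: measurable_mu_extE. Qed.

Lemma completed_measure_mono (A B : set T) : A `<=` B -> cmu A <= cmu B.
Proof. exact: le_mu_ext. Qed.

Lemma completed_negligible (A : set T) : mu.-negligible A -> cmu A = 0.
Proof.
move=> [N [mN N0 AN]]; apply/eqP; rewrite eq_le measure_ge0 andbT -N0.
by rewrite -(completed_measureE mN) completed_measure_mono.
Qed.

Lemma measurable_completed (A : set T) : measurable A -> measurable (A : set cT).
Proof. exact: caratheodory_measurable_mu_ext. Qed.

Lemma negligible_measurable_completed (A : set T) : mu.-negligible A -> measurable (A : set cT).
Proof.
move=> nA; apply: le_caratheodory_measurable => B.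
apply: (@le_trans _ _ ((mu^*)%mu A + (mu^*)%mu (B `&` ~` A))).
  by rewrite leeD2r// le_outer_measure//; exact: subIsetr.
have -> : (mu^*)%mu A = 0 := completed_negligible nA.
by rewrite add0e le_outer_measure//; exact: subIsetl.
Qed.

(** The completed measure is an outer measure evaluated on arbitrary subsets, so monotonicity and
    subadditivity apply to events not known to be measurable. *)
Lemma completed_ae_le (A B : set T) : {ae mu, forall w, A w -> B w} ->
  cmu A <= cmu B.
Proof.
move=> [N [mN N0 AN]].
apply: (@le_trans _ _ (cmu (B `|` N))).
  apply: completed_measure_mono => w Aw.
  by have [Bw|Bw] := pselect (B w); [left|right; apply: AN => /= /(_ Aw)].
have -> : cmu B = cmu B + cmu N.
  by rewrite (completed_measureE mN) N0 adde0.
exact: outer_measureU2.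
Qed.

Lemma completed_ae_eq (A B : set T) : {ae mu, forall w, A w <-> B w} ->
  cmu A = cmu B.
Proof.
move=> AB; apply/eqP; rewrite eq_le !completed_ae_le//; apply: filterS AB => w; by case.
Qed.

End completed_measure.

(** * Generators of the Borel sets of the cemetery space *)

Section borel_cemetery_generation.
Context {R : realType} {E : set (\bar R)}.
Local Notation Ed := (cemetery E).

Definition ray b (c : \bar R) : set Ed := [set q | exists2 e, q = Some e & c < dir b e].

Lemma open_ray b c : open (ray b c).
Proof.
by rewrite openE => _ [e -> ce]; rewrite /interior; exact: near_dir_gt.
Qed.

Lemma measurable_ray b c : measurable (ray b c : set (borel_cemetery E)).
Proof. by apply: sub_sigma_algebra; exact: open_ray. Qed.

(** Rational intervals, where [None] means no bound on that side: a countable base of the topology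
    of E. The upper bound is a ray in the reversed direction. *)
Let box (i : option rat * option rat) : set Ed := [set q | q <> None /\
  (if i.1 is Some r then ray false (ratr r)%:E q else True) /\
  (if i.2 is Some r then ray true (- (ratr r)%:E) q else True)].

Let lo (i : option rat) (y : \bar R) := if i is Some r then (ratr r)%:E < y else true.
Let hi (i : option rat) (y : \bar R) := if i is Some r then y < (ratr r)%:E else true.

Let nbhs_box (y : \bar R) (V : set (\bar R)) : nbhs y V ->
  exists i : option rat * option rat,
    [/\ lo i.1 y, hi i.2 y & forall x, lo i.1 x -> hi i.2 x -> V x].
Proof.
case: y => [y [d /= d0 dV]|[M [_ MV]]|[M [_ MV]]].
- have /ereal_rat_dense[q1 q1l q1r] : (y - d)%:E < y%:E by rewrite lte_fin gtrDl oppr_lt0.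
  have /ereal_rat_dense[q2 q2l q2r] : y%:E < (y + d)%:E by rewrite lte_fin ltrDl.
  exists (Some q1, Some q2); split => // -[x| |]//=; rewrite ?lte_fin => q1x xq2.
  apply: dV; rewrite /= ltr_distlC; move: q1l q2r; rewrite !lte_fin => q1l q2r.
  by rewrite (lt_trans q1l)// (lt_trans xq2).
- have /ereal_rat_dense[q ql qr] : M%:E < +oo by rewrite ltry.
  by exists (Some q, None); split => // x qx _; apply: MV; exact: lt_trans qx.
- have /ereal_rat_dense[q ql qr] : -oo < M%:E by rewrite ltNyr.
  by exists (None, Some q); split => // x _ qx; apply: MV; exact: lt_trans qr.
Qed.

(** Every extended real is above -oo or below +oo, so these two rays cover E. *)
Lemma cemeteryE : [set None] = [set q : Ed | ~ (ray false -oo q \/ ray true -oo q)].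
Proof.
apply/seteqP; split => [_ -> /= [] []//|[e|]//= ne]; exfalso; apply: ne.
have [eN|eN] := eqVneq (set_val e) -oo.
  by right; exists e => //; rewrite /dir eN.
by left; exists e => //; rewrite /dir ltNye.
Qed.

Lemma measurable_cemetery : measurable ([set None] : set (borel_cemetery E)).
Proof.
have sM := measurable_sigma_algebra (borel_cemetery E).
rewrite cemeteryE; apply: (sigma_not sM).
by apply: (sigma_or sM); exact: measurable_ray.
Qed.

Lemma measurable_point (q : Ed) : measurable ([set q] : set (borel_cemetery E)).
Proof.
case: q => [e|]; last exact: measurable_cemetery.
have sM := measurable_sigma_algebra (borel_cemetery E).
rewrite (_ : [set _] = [set q : Ed | ~ (q = None) /\
    ~ (ray false (dir false e) q \/ ray true (dir true e) q)]).
  apply: (sigma_and sM); first exact: (sigma_not sM measurable_cemetery).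
  by apply: (sigma_not sM); apply: (sigma_or sM); exact: measurable_ray.
apply/seteqP; split => [_ ->|[v|] [//= _ ne]].
  by split => // -[] [_ [<-]]; rewrite ltxx.
congr Some; apply: (@dir_inj _ _ false); apply: contrapT => /eqP.
rewrite neq_lt => /orP[|] ve; apply: ne; [right|left]; exists v => //.
by rewrite (dir_ltN false).
Qed.

(** An open set is the countable union of the boxes it contains, plus possibly the cemetery, whose
    singleton is the complement of two rays. *)
Lemma borel_cemetery_ind (M : set (set Ed)) : sigma_algebra setT M ->
  (forall b c, M (ray b c)) -> <<s @open Ed >> `<=` M.
Proof.
move=> sM Mray; apply: smallest_sub => // U oU.
have MN : M [set None].
  rewrite cemeteryE; apply: (sigma_not sM).
  by apply: (sigma_or sM); exact: Mray.
have Mbox i : M (box i).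
  apply: (sigma_and sM); first exact: (sigma_not sM MN).
  apply: (sigma_and sM).
    by case: i.1 => [r|]; [exact: Mray|exact: (sigma_const sM)].
  by case: i.2 => [r|]; [exact: Mray|exact: (sigma_const sM)].
rewrite (_ : U = [set q | (q = None /\ U None) \/ exists i, box i `<=` U /\ box i q]).
  apply: (sigma_or sM).
    by apply: (sigma_and sM) => //; exact: (sigma_const sM).
  by apply: (sigma_exists sM) => i; apply: (sigma_and sM) => //; exact: (sigma_const sM).
apply/seteqP; split => [[e|] Uq|q [[-> //]|[i [+ iq]]]]; [|by left|exact].
right; have : nbhs (Some e : Ed) U by apply: open_nbhs_nbhs.
rewrite nbhs_SomeE nbhsE => -[W [[V oV VW] We] WU].
have : nbhs (set_val e) V by apply: open_nbhs_nbhs; split => //; move: We; rewrite -VW.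
move=> /nbhs_box[[i j] /= [ie je ijV]]; exists (i, j); split.
  move=> [v|] [//= _ [iv jv]]; apply: WU; rewrite -VW; apply: ijV => /=.
    by case: i {ie} iv => // r [_ [<-]].
  by case: j {je} jv => // r [_ [<-]]; rewrite /dir ?EFinN lteN2.
split => //; split => /=; first by case: i ie ijV => // r re _; exists e.
by case: j je ijV => // r re _; exists e => //; rewrite /dir ?EFinN lteN2.
Qed.

End borel_cemetery_generation.

(** * Measurability of entrance times *)

Section entrance_measurability.
Context {R : realType} {E : set (\bar R)} {Omega : pointedType}.
Local Notation Ed := (cemetery E).
Variable X : \bar R -> Omega -> Ed.
Implicit Types (b : bool) (c : \bar R) (s t : R) (w : Omega).

Definition trajectory w : R -> Ed := fun t => X t%:E w.

Definition entry b c w : \bar R := entrance b (trajectory w) c.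

Hypothesis regX : forall w, regular_path (trajectory w).

Section in_sigma_algebra.
Variables (M : set (set Omega)) (t : R).
Hypotheses (sM : sigma_algebra setT M) (t0 : (0 <= t)%R).
Hypothesis MX : forall s (B : set (borel_cemetery E)), (0 <= s <= t)%R ->
  measurable B -> M [set w | B (X s%:E w)].

(** By right-continuity a value above a level is also seen at a slightly later rational time, except
    at t itself, which is listed apart. The alternative c = -oo reflects the value -oo of the
    supremum for paths issued from the cemetery. *)
Let runsupE b c w : c <= runsup b (trajectory w) t <-> c = -oo \/ (X 0 w <> None /\
  forall n, ray b (below c n) (X t%:E w) \/
    exists q : rat, (0 <= (ratr q : R) <= t)%R /\ ray b (below c n) (X (ratr q)%:E w)).
Proof.
split=> [ct|[->|[X0 h]]]; last 2 first.
- exact: leNye.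
- apply: below_le => n; case: (h n) => [[e Xt ne]|[q [qt [e Xq ne]]]].
    apply: (le_trans (ltW ne)); apply: (@runsup_ge _ _ _ _ t) => //.
    by rewrite t0 lexx.
  by apply: (le_trans (ltW ne)); apply: (@runsup_ge _ _ _ _ (ratr q)).
have [->|cN] := eqVneq c -oo; [by left|right].
have lt n : below c n < runsup b (trajectory w) t.
  by apply: lt_le_trans ct; apply: below_lt; rewrite ltNye.
split; first by have [] := runsup_gt (lt 0%N).
move=> n; have [_ [s [e [/andP[s0 st] Xs ne]]]] := runsup_gt (lt n).
move: st; rewrite le_eqVlt => /orP[/eqP <-|st]; first by left; exists e.
right; have : \forall r \near s^'+, ray b (below c n) (X r%:E w).
  have pr := path_right (regX w) s0; rewrite Xs in pr.
  exact: (pr _ (near_dir_gt ne)).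
move=> [d /= d0 dX].
have /rat_in_itvoo[q] : (s < Num.min t (s + d))%R by rewrite lt_min st ltrDl.
rewrite in_itv/= lt_min => /andP[sq /andP[qt qd]]; exists q; split.
  by rewrite (le_trans s0) ltW.
by apply: dX => //=; rewrite distrC ger0_norm ?subr_ge0 ?(ltW sq)// ltrBlDl.
Qed.

Lemma sigma_runsup b c : M [set w | c <= runsup b (trajectory w) t].
Proof.
rewrite (_ : mkset _ = [set w | c = -oo \/ (X 0 w <> None /\
  forall n, ray b (below c n) (X t%:E w) \/
    exists q : rat, (0 <= (ratr q : R) <= t)%R /\ ray b (below c n) (X (ratr q)%:E w))]).
  apply: (sigma_or sM); first exact: (sigma_const sM).
  apply: (sigma_and sM).
    apply: (sigma_not sM).
    by apply: (MX (s := 0%R) (B := [set None])); rewrite ?lexx//; exact: measurable_cemetery.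
  apply: (sigma_forall sM) => n; apply: (sigma_or sM).
    by apply: MX; [rewrite t0 lexx|exact: measurable_ray].
  apply: (sigma_exists sM) => q.
  have [qt|qt] := boolP (0 <= (ratr q : R) <= t)%R.
    apply: (sigma_and sM); first exact: (sigma_const sM).
    by apply: MX => //; exact: measurable_ray.
  rewrite [X in M X](_ : _ = [set w | False]); first exact: (sigma_const sM).
  by apply/seteqP; split => w //= [].
by apply/seteqP; split => w /= /runsupE.
Qed.

Lemma sigma_entry b c : M [set w | entry b c w <= t%:E].
Proof.
rewrite (_ : mkset _ = [set w | c <= runsup b (trajectory w) t]).
  exact: sigma_runsup.
by apply/seteqP; split => w /=; rewrite /entry entrance_le.
Qed.

End in_sigma_algebra.

Lemma measurable_coordinate (s : \bar R) (B : set (borel_cemetery E)) : 0 <= s ->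
  measurable B -> measurable ([set w | B (X s w)] : set (path_space X)).
Proof.
move=> s0 mB; apply: sub_sigma_algebra; exists s => //=.
  by rewrite s0 leey.
by exists B.
Qed.

Lemma measurable_entry_le b c t :
  measurable ([set w | entry b c w <= t%:E] : set (path_space X)).
Proof.
have [t0|t0] := leP 0%R t.
  apply: sigma_entry => //; first exact: measurable_sigma_algebra.
  by move=> s B /andP[s0 _]; apply: measurable_coordinate; rewrite lee_fin.
rewrite (_ : mkset _ = set0); first exact: measurable0.
apply/seteqP; split => w //=.
by rewrite leNgt (lt_le_trans _ (entrance_ge0 _ _ _))// lte_fin.
Qed.

Lemma entry_ltP b c b' c' w : entry b c w < entry b' c' w <->
  exists q : rat, entry b c w <= (ratr q)%:E /\ ~ (entry b' c' w <= (ratr q)%:E).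
Proof.
split=> [/ereal_rat_dense[q ql qr]|[q [ql /negP]]].
  by exists q; rewrite (ltW ql); split => //; apply/negP; rewrite -ltNge.
by rewrite -ltNge; exact: le_lt_trans.
Qed.

Lemma measurable_entry_lt b c b' c' :
  measurable ([set w | entry b c w < entry b' c' w] : set (path_space X)).
Proof.
rewrite (_ : mkset _ = [set w | exists q : rat, entry b c w <= (ratr q)%:E /\
    ~ (entry b' c' w <= (ratr q)%:E)]); last by apply/seteqP; split => w /= /entry_ltP.
have sM := measurable_sigma_algebra (path_space X).
apply: (sigma_exists sM) => q; apply: (sigma_and sM); first exact: measurable_entry_le.
by apply: (sigma_not sM); exact: measurable_entry_le.
Qed.

End entrance_measurability.

(** * The augmented filtration *)

Section filtrations.
Context {R : realType} {E : set (\bar R)} {Omega : pointedType}.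
Local Notation Ed := (cemetery E).
Variables (X : \bar R -> Omega -> Ed) (theta : \bar R -> Omega -> Omega).
Variable P : R.-pker (borel_cemetery E) ~> (path_space X).
Hypothesis HX : hunt_process theta P.
Implicit Types (b : bool) (c : \bar R) (s t : R) (w : Omega).

Lemma hunt_regular w : regular_path (trajectory X w).
Proof.
split.
- move=> s t s0 st Xs; apply: (hunt_absorbing HX); first by rewrite lee_fin (le_trans (ltW s0)).
  apply: (@le_trans _ _ s%:E); last by rewrite lee_fin.
  by apply: ereal_inf_lbound.
- by move=> t t0; apply: (hunt_right_continuous HX).
- by move=> t t0; apply: (hunt_left_limit HX).
Qed.

Lemma filtration_sigma_algebra (t : \bar R) : sigma_algebra setT (filtration P t).
Proof.
split => [mu|A FA mu|A FA mu].
- by case: (smallest_sigma_algebra setT (cylinders X t `|` (mixture P mu).-negligible)).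
- case: (smallest_sigma_algebra setT (cylinders X t `|` (mixture P mu).-negligible)) => _ + _.
  by apply; exact: FA.
- case: (smallest_sigma_algebra setT (cylinders X t `|` (mixture P mu).-negligible)) => _ _.
  by apply => n; exact: FA.
Qed.

Lemma filtration_coordinate (s t : \bar R) (B : set (borel_cemetery E)) : 0 <= s <= t ->
  measurable B -> filtration P t [set w | B (X s w)].
Proof.
move=> st mB mu; apply: sub_sigma_algebra; left; exists s => //.
by exists B.
Qed.

Lemma filtration_nd (s t : \bar R) : s <= t -> filtration P s `<=` filtration P t.
Proof.
move=> st A FA mu.
suff : <<s cylinders X s `|` (mixture P mu).-negligible >> `<=`
    <<s cylinders X t `|` (mixture P mu).-negligible >> by apply; exact: FA.
apply: smallest_sub; first exact: smallest_sigma_algebra.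
apply: subset_trans (@sub_sigma_algebra _ _ _) => B [|]; last by right.
move=> [r /andP[r0 rs] [C mC <-]]; left; exists r; last by exists C.
by rewrite /= r0 (le_trans rs).
Qed.

Lemma filtration_negligible (t : \bar R) A :
  (forall mu, (mixture P mu).-negligible A) -> filtration P t A.
Proof. by move=> nA mu; apply: sub_sigma_algebra; right. Qed.

Lemma filtration_measurable (t : \bar R) A (mu : probability (borel_cemetery E) R) :
  filtration P t A ->
  measurable (A : set (caratheodory_type (mu_ext (mixture P mu)))).
Proof.
suff : <<s cylinders X t `|` (mixture P mu).-negligible >> `<=`
    @measurable _ (caratheodory_type (mu_ext (mixture P mu))).
  by move=> h /(_ mu); exact: h.
apply: smallest_sub.
  exact: (measurable_sigma_algebra (caratheodory_type (mu_ext (mixture P mu)))).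
move=> B [[s /andP[s0 _] [C mC <-]]|].
  by apply: measurable_completed; exact: measurable_coordinate.
exact: negligible_measurable_completed.
Qed.

Lemma entry_stopping b c : stopping_time P (entry X b c).
Proof.
split=> [w|[t| |]//]; first exact: entrance_ge0.
  move=> t0; apply: sigma_entry => //; first exact: hunt_regular.
    exact: filtration_sigma_algebra.
  by move=> s B st; apply: filtration_coordinate; rewrite !lee_fin.
move=> _; rewrite (_ : mkset _ = [set w | True]).
  exact: (sigma_const (filtration_sigma_algebra _)).
by apply/seteqP; split => w //= _; rewrite leey.
Qed.

End filtrations.

Section negligible_predicates.
Context d (T : measurableType d) (R : realType) (mu : {measure set T -> \bar R}).

Lemma negligible_exists (I : countType) (A : I -> set T) :
  (forall i, mu.-negligible (A i)) -> mu.-negligible [set w | exists i, A i w].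
Proof.
move=> nA; pose F n := if unpickle n is Some i then A i else set0.
apply: (@negligibleS _ _ _ _ (\bigcup_n F n)).
  by move=> w [i Ai]; exists (pickle i) => //; rewrite /F pickleK.
apply: negligible_bigcup => n; rewrite /F; case: unpickle => //.
exact: negligible_set0.
Qed.

Lemma negligible_not (A : set T) : mu setT = 1 -> measurable A -> mu A = 1 ->
  mu.-negligible [set w | ~ A w].
Proof.
move=> m1 mA A1; apply/negligibleP; first exact: measurableC.
suff : mu (~` A) = 0 by [].
have : mu setT = mu A + mu (~` A).
  rewrite -measureU ?setUCr ?setICr//; exact: measurableC.
rewrite m1 A1; case: (mu (~` A)) (measure_ge0 mu (~` A)) => [r| |]// r0 /eqP.
by rewrite -EFinD eqe -subr_eq0 opprD addrA subrr add0r oppr_eq0 => /eqP ->.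
Qed.

End negligible_predicates.

(** * Stopping times and the position at a stopping time *)

Section stopping_times.
Context {R : realType} {E : set (\bar R)} {Omega : pointedType}.
Local Notation Ed := (cemetery E).
Variables (X : \bar R -> Omega -> Ed) (theta : \bar R -> Omega -> Omega).
Variable P : R.-pker (borel_cemetery E) ~> (path_space X).
Hypothesis HX : hunt_process theta P.
Implicit Types (b : bool) (c : \bar R) (s t : R) (w : Omega).

(** Absorption does not exclude these paths. They form a null set, outside of which the value at a
    stopping time can be recovered from later values. *)
Let resurrected : set Omega :=
  [set w | X 0 w = None /\ exists q : rat, (0 < (ratr q : R))%R /\ X (ratr q)%:E w <> None].

Let resurrected_negligible (mu : probability (borel_cemetery E) R) :
  (mixture P mu).-negligible resurrected.
Proof.
have sM := measurable_sigma_algebra (path_space X).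
have mX t : (0 <= t)%R -> measurable ([set w | X t%:E w = None] : set (path_space X)).
  move=> t0; apply: (@measurable_coordinate _ _ _ X t%:E [set None]).
    by rewrite lee_fin.
  exact: measurable_cemetery.
have mres : measurable (resurrected : set (path_space X)).
  apply: (sigma_and sM); first exact: mX.
  apply: (sigma_exists sM) => q; have [q0|q0] := boolP (0 < (ratr q : R))%R; last first.
    rewrite [X in measurable X](_ : _ = [set w | False]); first exact: (sigma_const sM).
    by apply/seteqP; split => w //= [].
  apply: (sigma_and sM); first exact: (sigma_const sM).
  by apply: (sigma_not sM); apply: mX; exact: ltW.
apply/negligibleP => //; apply: integral0_eq => z _.
apply/negligibleP => //.
have P1 : P z setT = 1 by exact: prob_kernel.
case: z P1 => [e|] P1; last first.
  apply: (@negligibleS _ (path_space X) _ _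
    [set w | exists q : rat, (0 < (ratr q : R))%R /\ X (ratr q)%:E w <> None]).
    by move=> w [].
  apply: negligible_exists => q.
  have [q0|q0] := boolP (0 < (ratr q : R))%R; last first.
    by apply: (@negligibleS _ _ _ _ set0); [by move=> w []|exact: negligible_set0].
  apply: (@negligibleS _ (path_space X) _ _ [set w | ~ [set w | X (ratr q)%:E w = None] w]).
    by move=> w [].
  apply: negligible_not => //; first by apply: mX; exact: ltW.
  by apply: (hunt_cemetery HX); rewrite lee_fin ltW.
apply: (@negligibleS _ (path_space X) _ _ [set w | ~ [set w | X 0 w = Some e] w]).
  by move=> w [X0 _] /=; rewrite X0.
apply: negligible_not => //; last exact: (hunt_normal HX).
exact: (@measurable_coordinate _ _ _ X 0 [set Some e] (lexx _) (measurable_point _)).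
Qed.

Section fixed_stopping_time.
Variable T : Omega -> \bar R.
Hypothesis stT : stopping_time P T.

Lemma stopping_le s (t : \bar R) : s%:E <= t -> filtration P t [set w | T w <= s%:E].
Proof.
move=> st; have [s0|s0] := leP 0%R s.
  by apply: (filtration_nd st); apply: stT.2; rewrite lee_fin.
rewrite (_ : mkset _ = [set w | False]).
  exact: (sigma_const (filtration_sigma_algebra _ _)).
apply/seteqP; split => w //= Ts; have := stT.1 w.
by rewrite leNgt (le_lt_trans Ts)// lte_fin.
Qed.

Lemma stopping_lt s (t : \bar R) : s%:E <= t -> filtration P t [set w | T w < s%:E].
Proof.
move=> st; have sF := filtration_sigma_algebra P t.
rewrite (_ : mkset _ = [set w | exists q : rat, (ratr q)%:E < s%:E /\ T w <= (ratr q)%:E]).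
  apply: (sigma_exists sF) => q; have [qs|qs] := boolP ((ratr q)%:E < s%:E).
    apply: (sigma_and sF); first exact: (sigma_const sF).
    by apply: stopping_le; rewrite (le_trans (ltW qs)).
  rewrite [X in filtration P t X](_ : _ = [set w | False]); first exact: (sigma_const sF).
  by apply/seteqP; split => w //= [].
apply/seteqP; split => w /= [].
  by move=> /ereal_rat_dense[q Tq qs]; exists q; split => //; exact: ltW.
by move=> q [qs Tq]; exact: le_lt_trans Tq qs.
Qed.

(* For T w < t, the value X_T is in an open ray iff the values at rational times
   shortly after T are in a smaller ray. *)
Let stopped_ray b c t : (0 <= t)%R ->
  filtration P t%:E [set w | ray b c (X (T w) w) /\ T w <= t%:E].
Proof.
move=> t0; have sF := filtration_sigma_algebra P t%:E.
(* At T = t no later time is available, and X_t is read off directly. Otherwise [z] leaves a margin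
   above [c] and [p] is a delay; the negated inequality says q < T + p while comparing T with
   constants only. *)
pose A := [set w | T w <= t%:E /\ ((~ T w < t%:E /\ ray b c (X t%:E w)) \/
  (T w < t%:E /\ exists z : rat, c < (ratr z)%:E /\ exists p : rat, (0 < (ratr p : R))%R /\
    forall q : rat, ((ratr q : R) <= t)%R -> T w < (ratr q)%:E ->
       ~ (T w <= (ratr q - ratr p)%:E) -> ray b (ratr z)%:E (X (ratr q)%:E w)))].
apply: (@sigma_iff _ _ sF A _ [set w | ~ resurrected w]).
- apply: (sigma_and sF); first exact: stopping_le.
  apply: (sigma_or sF).
    apply: (sigma_and sF); first by apply: (sigma_not sF); exact: stopping_lt.
    by apply: filtration_coordinate; rewrite ?lee_fin ?t0 ?lexx//; exact: measurable_ray.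
  apply: (sigma_and sF); first exact: stopping_lt.
  apply: (sigma_exists sF) => z; apply: (sigma_and sF); first exact: (sigma_const sF).
  apply: (sigma_exists sF) => p; have [p0|p0] := boolP (0 < (ratr p : R))%R; last first.
    rewrite [X in filtration P _ X](_ : _ = [set w | False]); first exact: (sigma_const sF).
    by apply/seteqP; split => w //= [].
  apply: (sigma_and sF); first exact: (sigma_const sF).
  apply: (sigma_forall sF) => q; have [qt|qt] := boolP ((ratr q : R) <= t)%R; last first.
    rewrite [X in filtration P _ X](_ : _ = [set w | True]); first exact: (sigma_const sF).
    by apply/seteqP; split => w //=.
  apply: (sigma_imply sF); first exact: (sigma_const sF).
  have [q0|q0] := leP 0%R (ratr q : R); last first.
    rewrite [X in filtration P _ X](_ : _ = [set w | True]); first exact: (sigma_const sF).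
    apply/seteqP; split => w //= _; rewrite ltNge (le_trans _ (stT.1 w))//.
    by rewrite lee_fin ltW.
  apply: (sigma_imply sF); first by apply: stopping_lt; rewrite lee_fin.
  apply: (sigma_imply sF).
    apply: (sigma_not sF); apply: stopping_le; rewrite lee_fin.
    by rewrite (le_trans _ qt)// gerBl ltW.
  by apply: filtration_coordinate; rewrite ?lee_fin ?q0//; exact: measurable_ray.
- apply: (sigma_not sF); exact: filtration_negligible.
- move=> w nres; rewrite /A/=; split=> [[Tt [[nTt Xt]|[Tt' [z [cz [p [p0 Xq]]]]]]]|[XT Tt]].
  + split => //; suff -> : T w = t%:E by [].
    by apply/eqP; rewrite eq_le Tt leNgt; apply/negP.
  + split => //; have [s s0 Ts] : exists2 s, (0 <= s)%R & T w = s%:E.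
      exists (fine (T w)); first by rewrite fine_ge0// stT.1.
      by rewrite fineK// ge0_fin_numE ?stT.1// (lt_trans Tt')// ltry.
    rewrite Ts in Tt' Xq *; rewrite lte_fin in Tt'.
    have {}Xq q : (s < ratr q < Num.min t (s + ratr p))%R -> ray b (ratr z)%:E (X (ratr q)%:E w).
      rewrite lt_min => /andP[sq /andP[qt qp]]; apply: Xq; [exact: ltW|by rewrite lte_fin|].
      by apply/negP; rewrite lee_fin -ltNge ltrBlDr.
    have st : (s < Num.min t (s + ratr p))%R by rewrite lt_min Tt' ltrDl.
    case Xs : (X s%:E w) => [e|].
      exists e => //; rewrite ltNge; apply/negP => ec.
      have [d /= d0 dX] : \forall r \near s^'+, exists2 v, X r%:E w = Some v & dir b v < (ratr z)%:E.
        have pr := path_right (hunt_regular HX w) s0; rewrite /trajectory Xs in pr.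
        exact: (pr _ (near_dir_lt (le_lt_trans ec cz))).
      have /rat_in_itvoo[q] : (s < Num.min (Num.min t (s + ratr p)) (s + d))%R by rewrite lt_min st ltrDl.
      rewrite in_itv/= lt_min => /andP[sq /andP[qm qd]].
      have [||v Xv vz] := dX (ratr q) => //.
        by rewrite /= distrC ger0_norm ?subr_ge0 ?(ltW sq)// ltrBlDl.
      have [|u] := Xq q; first by rewrite sq.
      by rewrite Xv => -[<-]; rewrite ltNge (ltW vz).
    (* Were the path at the cemetery at time T, it would be alive at a later rational time:
       absorption forbids this if T > 0, and [nres] if T = 0. *)
    exfalso; have /rat_in_itvoo[q] := st; rewrite in_itv/= => /andP[sq qm].
    have [|v Xv _] := Xq q; first by rewrite sq.
    have [s00|s00] := eqVneq s 0%R.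
      apply: nres; split; first by move: Xs; rewrite s00.
      by exists q; rewrite Xv; split => //; rewrite -s00.
    have s0' : (0 < s)%R by rewrite lt_neqAle eq_sym s00.
    by have := path_absorbed (hunt_regular HX w) s0' (ltW sq) Xs; rewrite /trajectory Xv.
  + split => //; have [Tt'|Tt'] := boolP (T w < t%:E); last first.
      left; split => //; suff <- : T w = t%:E by [].
      by apply/eqP; rewrite eq_le Tt leNgt.
    right; split => //; have [e Xe ce] := XT.
    have [s s0 Ts] : exists2 s, (0 <= s)%R & T w = s%:E.
      exists (fine (T w)); first by rewrite fine_ge0// stT.1.
      by rewrite fineK// ge0_fin_numE ?stT.1// (lt_trans Tt')// ltry.
    rewrite Ts in Xe *.
    have [z cz ze] := ereal_rat_dense ce; exists z; split => //.
    have [d /= d0 dX] : \forall r \near s^'+, ray b (ratr z)%:E (X r%:E w).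
      have pr := path_right (hunt_regular HX w) s0; rewrite /trajectory Xe in pr.
      exact: (pr _ (near_dir_gt ze)).
    have /rat_in_itvoo[p] := d0; rewrite in_itv/= => /andP[p0 pd].
    exists p; split => // q qt; rewrite lte_fin => sq /negP; rewrite lee_fin -ltNge => qps.
    apply: dX => //=; rewrite distrC ger0_norm ?subr_ge0 ?(ltW sq)//.
    by rewrite ltrBlDl (lt_trans _ (_ : s + ratr p < s + d)%R) ?ltrD2l// -ltrBlDr.
- apply: filtration_negligible => mu; apply: negligibleS (resurrected_negligible mu).
  by move=> w [/contrapT].
Qed.

Lemma stopped_coordinate (B : set (borel_cemetery E)) : measurable B ->
  stopped_filtration P T [set w | B (X (T w) w)].
Proof.
move=> mB t t0; move: B mB.
have sF := filtration_sigma_algebra P t.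
suff : <<s @open Ed >> `<=`
    [set B | filtration P t ([set w | B (X (T w) w)] `&` [set w | T w <= t])] by [].
apply: borel_cemetery_ind.
  split => /=.
  - rewrite set0I; exact: (sigma_const sF False).
  - move=> A FA; rewrite [X in filtration P t X](_ : _ = [set w | T w <= t /\
        ~ ([set w | A (X (T w) w)] `&` [set w | T w <= t]) w]).
      by apply: (sigma_and sF); [exact: stT.2|exact: (sigma_not sF)].
    apply/seteqP; split => w /=; first by move=> [[_ nA] Tt]; split => // -[].
    by move=> [Tt nA]; split => //; split => // Aw; apply: nA.
  - move=> A FA; rewrite [X in filtration P t X](_ : _ = [set w | exists n,
        ([set w | A n (X (T w) w)] `&` [set w | T w <= t]) w]).
      exact: (sigma_exists sF).
    apply/seteqP; split => w /=; first by move=> [[n _ An] Tt]; exists n.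
    by move=> [n [An Tt]]; split => //; exists n.
move=> b c /=; case: t t0 sF => [t| |]//; first by move=> t0 _; exact: stopped_ray.
(* For t = +oo the event is a union over integer bounds on T: where T = +oo the path is at the
   cemetery, outside every ray. *)
move=> _ sF; rewrite [X in filtration P _ X](_ : _ = [set w | exists n : nat,
    ray b c (X (T w) w) /\ T w <= n%:R%:E]).
  apply: (sigma_exists sF) => n; apply: (@filtration_nd _ _ _ _ P n%:R%:E); first exact: leey.
  exact: stopped_ray.
apply/seteqP; split => w /=; last by move=> [n [Xw _]]; split => //; rewrite leey.
move=> [Xw _]; have : T w != +oo.
  by apply/eqP => Too; move: Xw => []; rewrite Too (hunt_infty HX).
rewrite -ltey => Too; exists (Num.bound (fine (T w))); split => //.
rewrite -(@fineK _ (T w)) ?ge0_fin_numE ?stT.1// lee_fin ltW//.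
exact: unstable.ltr_bound.
Qed.

Lemma stopped_filtrationI A B : stopped_filtration P T A -> stopped_filtration P T B ->
  stopped_filtration P T (A `&` B).
Proof.
move=> FA FB t t0; have sF := filtration_sigma_algebra P t.
rewrite [X in filtration P t X](_ : _ = [set w | (A `&` [set w | T w <= t]) w /\
   (B `&` [set w | T w <= t]) w]).
  by apply: (sigma_and sF); [exact: FA|exact: FB].
by apply/seteqP; split => w /= => [[[? ?] ?]|[[? ?] [? ?]]].
Qed.

Lemma stopping_shift s : (0 <= s)%R -> stopping_time P (fun w => T w + s%:E).
Proof.
move=> s0; split=> [w|t t0]; first by rewrite adde_ge0// ?stT.1// lee_fin.
rewrite (_ : mkset _ = [set w | T w <= t - s%:E]); last first.
  by apply/seteqP; split => w; rewrite /mkset leeBrDr.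
have le : t - s%:E <= t by rewrite leeBlDr// leeDl// lee_fin.
case: t t0 le => [t| |]// t0 le; last by apply: (stT.2 +oo).
by rewrite -EFinB; apply: stopping_le.
Qed.

Lemma stopped_filtration_shift A s : (0 <= s)%R -> stopped_filtration P T A ->
  stopped_filtration P (fun w => T w + s%:E) A.
Proof.
move=> s0 FA t t0; have sF := filtration_sigma_algebra P t.
rewrite (_ : [set w | T w + s%:E <= t] = [set w | T w <= t - s%:E]); last first.
  by apply/seteqP; split => w; rewrite /mkset leeBrDr.
have le : t - s%:E <= t by rewrite leeBlDr// leeDl// lee_fin.
have [ts|ts] := leP 0 (t - s%:E).
  by apply: (filtration_nd le); exact: FA.
rewrite [X in filtration P t X](_ : _ = [set w | False]); first exact: (sigma_const sF).
apply/seteqP; split => w //= [_ Tw]; have := stT.1 w.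
by rewrite leNgt (le_lt_trans Tw).
Qed.

Lemma stopped_measurable A (mu : probability (borel_cemetery E) R) :
  stopped_filtration P T A ->
  measurable (A : set (caratheodory_type (mu_ext (mixture P mu)))).
Proof.
move=> /(_ +oo); rewrite (_ : [set w | T w <= +oo] = setT).
  by rewrite setIT => h; apply: filtration_measurable; apply: h.
by apply/seteqP; split => w //= _; rewrite leey.
Qed.

End fixed_stopping_time.

Lemma cst_stopping s : (0 <= s)%R -> stopping_time P (fun=> s%:E).
Proof.
move=> s0; split=> [w|t t0]; first by rewrite lee_fin.
exact: (sigma_const (filtration_sigma_algebra _ _)).
Qed.

End stopping_times.

(** * The strong Markov property on path space *)

Section integral_transfer.
Context d1 d2 d3 (T1 : measurableType d1) (T2 : measurableType d2)
  (Y : measurableType d3) (R : realType).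

Lemma ge0_integral_mrestr d (T : measurableType d) (m : {measure set T -> \bar R})
    (A : set T) (mA : measurable A) (g : T -> \bar R) :
  measurable_fun setT g -> (forall x, 0 <= g x) ->
  \int[mrestr m mA]_x g x = \int[m]_(x in A) g x.
Proof.
move=> mg g0; have mAC := measurableC mA.
rewrite -(setUCr A) ge0_integral_setU//; last 2 first.
- by rewrite setUCr.
- exact/disj_setPCl.
rewrite [X in _ + X]null_set_integral//; last 2 first.
- exact: measurable_funTS.
- by rewrite /= /mrestr setICl measure0.
rewrite adde0; apply: eq_measure_integral => B mB BA.
by rewrite /= /mrestr setIidl.
Qed.

(** Change of variables: the two image measures differ by the factor [k], which in the application
    is the probability of the conditioning event. *)
Lemma integral_law_eq (m1 : {measure set T1 -> \bar R}) (m2 : {measure set T2 -> \bar R})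
    (A1 : set T1) (A2 : set T2) (f1 : T1 -> Y) (f2 : T2 -> Y) (k : {nonneg R})
    (phi : Y -> \bar R) :
  measurable A1 -> measurable A2 ->
  measurable_fun setT f1 -> measurable_fun setT f2 ->
  measurable_fun setT phi -> (forall y, 0 <= phi y) ->
  (forall C, measurable C ->
    m1 (A1 `&` f1 @^-1` C) = k%:num%:E * m2 (A2 `&` f2 @^-1` C)) ->
  \int[m1]_(w in A1) phi (f1 w) = k%:num%:E * \int[m2]_(w in A2) phi (f2 w).
Proof.
move=> mA1 mA2 mf1 mf2 mphi phi0 law.
rewrite -(ge0_integral_mrestr m1 mA1) //; last exact: measurableT_comp.
rewrite -(ge0_integral_mrestr m2 mA2) //; last exact: measurableT_comp.
have := ge0_integral_pushforward mf1 (mrestr m1 mA1) measurableT mphi (fun y _ => phi0 y).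
rewrite preimage_setT => <-.
have := ge0_integral_pushforward mf2 (mrestr m2 mA2) measurableT mphi (fun y _ => phi0 y).
rewrite preimage_setT => <-.
pose mf1' := isMeasurableFun.Build _ _ _ _ _ mf1.
pose F1 : {mfun _ >-> _} := HB.pack f1 mf1'.
pose mf2' := isMeasurableFun.Build _ _ _ _ _ mf2.
pose F2 : {mfun _ >-> _} := HB.pack f2 mf2'.
rewrite -ge0_integral_mscale//.
apply: (@eq_measure_integral _ _ _ _ (mscale k (pushforward (mrestr m2 mA2) F2))
  (pushforward (mrestr m1 mA1) F1)) => C mC _.
by rewrite /= /mscale/= /pushforward /mrestr/= setIC law// [in RHS]setIC.
Qed.

End integral_transfer.

Section strong_markov.
Context {R : realType} {E : set (\bar R)} {Omega : pointedType}.
Local Notation Ed := (cemetery E).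
Variables (X : \bar R -> Omega -> Ed) (theta : \bar R -> Omega -> Omega).
Variable P : R.-pker (borel_cemetery E) ~> (path_space X).
Hypothesis HX : hunt_process theta P.
Implicit Types (s t u : R) (w : Omega) (mu nu : probability (borel_cemetery E) R).
Local Notation Pc mu := (@completed_measure_extension _ _ _ (mixture P mu)).
Local Notation cT mu := (caratheodory_type (mu_ext (mixture P mu))).

Lemma completed_le1 mu (A : set Omega) : Pc mu A <= 1.
Proof.
have <- : Pc mu setT = 1.
  transitivity (mixture P mu [set: path_space X]); first exact: completed_measureE.
  exact: probability_setT.
exact: (@completed_measure_mono _ (path_space X)).
Qed.

Lemma completed_fin_num mu (A : set Omega) : Pc mu A \is a fin_num.
Proof.
by rewrite ge0_fin_numE ?measure_ge0// (le_lt_trans (completed_le1 mu A))// ltry.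
Qed.

Lemma measurable_stopped_coordinate mu T : stopping_time P T ->
  measurable_fun setT (fun w : cT mu => X (T w) w : borel_cemetery E).
Proof.
move=> stT _ B mB; rewrite setTI.
exact: (stopped_measurable mu (stopped_coordinate HX stT mB)).
Qed.

Definition cylinder_after (T : Omega -> \bar R) (ts : seq R)
    (B : R -> set (borel_cemetery E)) : set Omega :=
  [set w | forall t, t \in ts -> B t (X (T w + t%:E) w)].

Lemma cylinder_after_rcons T ts B t : cylinder_after T (rcons ts t) B =
  cylinder_after T ts B `&` [set w | B t (X (T w + t%:E) w)].
Proof.
apply/seteqP; split => w /= => [h|[h1 h2] s].
  by split=> [s sts|]; apply: h; rewrite mem_rcons inE ?sts ?orbT ?eqxx.
by rewrite mem_rcons inE => /orP[/eqP ->|/h1].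
Qed.

Lemma cylinder_after_stopped T ts B t : stopping_time P T ->
  (forall s, measurable (B s)) -> (forall s, s \in ts -> (0 <= s <= t)%R) ->
  (0 <= t)%R -> stopped_filtration P (fun w => T w + t%:E) (cylinder_after T ts B).
Proof.
move=> stT mB; move: t; elim/last_ind: ts => [|ts u IH] t tst t0.
  rewrite (_ : cylinder_after _ _ _ = [set w | True]); last first.
    by apply/seteqP; split.
  move=> r r0; rewrite (_ : [set w | True] = setT)// setTI.
  exact: (stopping_shift stT t0).2.
have /andP[u0 ut] : (0 <= u <= t)%R by apply: tst; rewrite mem_rcons inE eqxx.
rewrite cylinder_after_rcons; apply: stopped_filtrationI.
  by apply: IH => // s sts; apply: tst; rewrite mem_rcons inE sts orbT.
have := stopped_coordinate HX (stopping_shift stT u0) (mB u).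
move=> /(stopped_filtration_shift (stopping_shift stT u0) (_ : 0 <= t - u)%R).
rewrite subr_ge0 => /(_ ut).
rewrite (_ : (fun w => T w + u%:E + (t - u)%:E) = (fun w => T w + t%:E))//.
by apply/funext => w; rewrite -addeA -EFinD subrKC.
Qed.

Section law_after_stopping_time.
Variables (mu nu : probability (borel_cemetery E) R) (T : Omega -> \bar R) (A : set Omega).
Hypotheses (stT : stopping_time P T) (FA : stopped_filtration P T A).
Hypothesis law_nu : forall B : set (borel_cemetery E), measurable B ->
  Pc mu (A `&` [set w | B (X (T w) w)]) = Pc mu A * nu B.

Let kA : {nonneg R} := NngNum (fine_ge0 (measure_ge0 (Pc mu) A)).

Let kAE : kA%:num%:E = Pc mu A.
Proof. by rewrite /= fineK// completed_fin_num. Qed.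

Let st0 : stopping_time P (fun=> 0) := cst_stopping P (lexx 0%R).

(** Induction on the number of times. The Markov property at T + u, for the last but one time u,
    makes both sides integrals of one function of the position at time u, so only the laws of that
    position on the preceding cylinders matter. Starting the list at 0 ensures that u exists and
    reduces the base case to [law_nu]. *)
Let law_sorted ts B : path <=%R 0%R ts -> (forall s, measurable (B s)) ->
  Pc mu (A `&` cylinder_after T (0%R :: ts) B) =
  Pc mu A * Pc nu (cylinder_after (fun=> 0) (0%R :: ts) B).
Proof.
elim/last_ind: ts B => [|ts t IH] B; last first.
  rewrite rcons_path => /andP[pts ut] mB; pose u := last 0%R ts.
  have le0 s : s \in ts -> (0 <= s)%R.
    by move: pts; rewrite path_sortedE; [move=> /andP[/allP h _] /h|exact: le_trans].
  have u_in : u \in 0%R :: ts by exact: mem_last.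
  have leu s : s \in 0%R :: ts -> (0 <= s <= u)%R.
    move=> sts; apply/andP; split.
      by move: sts; rewrite inE => /orP[/eqP ->|/le0].
    have := pts; rewrite -/(sorted <=%R (0%R :: ts)) => srt.
    have [i /andP[_ iu] si] : exists2 i, (0 <= i <= size ts)%N & s = nth 0%R (0%R :: ts) i.
      exists (index s (0%R :: ts)); last by rewrite nth_index.
      by rewrite leq0n; have := sts; rewrite -index_mem [size _]/= ltnS.
    rewrite si /u (last_nth 0%R).
    by apply: (sorted_leq_nth le_trans lexx 0%R srt) => //; rewrite inE/= ltnS.
  have u0 : (0 <= u)%R by case/andP: (leu _ u_in).
  have r0 : (0 <= t - u)%R by rewrite subr_ge0.
  rewrite -rcons_cons !cylinder_after_rcons setIA.
  have stTu := stopping_shift stT u0.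
  have st0u := stopping_shift st0 u0.
  have FA1 : stopped_filtration P (fun w => T w + u%:E) (A `&` cylinder_after T (0%R :: ts) B).
    apply: stopped_filtrationI; first exact: stopped_filtration_shift.
    exact: cylinder_after_stopped.
  have FA2 : stopped_filtration P (fun w => 0 + u%:E) (cylinder_after (fun=> 0) (0%R :: ts) B).
    exact: cylinder_after_stopped.
  have := hunt_strong_markov HX mu stTu (_ : 0 <= (t - u)%:E) (mB t) FA1.
  rewrite lee_fin => /(_ r0).
  rewrite (_ : [set w | B t (X (T w + u%:E + (t - u)%:E) w)] =
      [set w | B t (X (T w + t%:E) w)]); last first.
    by apply/seteqP; split => w; rewrite /mkset -addeA -EFinD subrKC.
  move=> ->.
  have := hunt_strong_markov HX nu st0u (_ : 0 <= (t - u)%:E) (mB t) FA2.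
  rewrite lee_fin => /(_ r0).
  rewrite (_ : [set w | B t (X (0 + u%:E + (t - u)%:E) w)] =
      [set w | B t (X (0 + t%:E) w)]); last first.
    by apply/seteqP; split => w; rewrite /mkset !add0e -EFinD subrKC.
  move=> ->; rewrite -kAE.
  apply: (@integral_law_eq _ _ _ (cT mu) (cT nu) (borel_cemetery E) R (Pc mu) (Pc nu) _ _
     (fun w => X (T w + u%:E) w) (fun w => X (0 + u%:E) w) kA
     (fun z => P z (X (t - u)%:E @^-1` B t))).
  - exact: (stopped_measurable mu FA1).
  - exact: (stopped_measurable nu FA2).
  - exact: measurable_stopped_coordinate.
  - exact: measurable_stopped_coordinate.
  - apply: measurable_kernel; apply: (@measurable_coordinate _ _ _ X (t - u)%:E).
      by rewrite lee_fin.
    exact: mB.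
  - by [].
  (* A condition C on the position at time u is absorbed into the constraint at u; the induction
     hypothesis then gives the law of this position. *)
  move=> C mC; pose B' s := if s == u then B s `&` C else B s.
  have mB' s : measurable (B' s) by rewrite /B'; case: ifPn => // _; exact: measurableI.
  have cylC T' : cylinder_after T' (0%R :: ts) B `&` (fun w => X (T' w + u%:E) w) @^-1` C =
      cylinder_after T' (0%R :: ts) B'.
    apply/seteqP; split => [w [h Cw] s sts|w h].
      rewrite /B'; case: ifPn => [/eqP su|_]; last exact: h.
      by split; [exact: h|rewrite su].
    split=> [s sts|]; first by have := h s sts; rewrite /B'; case: ifPn => // _ [].
    by have := h u u_in; rewrite /B' eqxx => -[].
  by rewrite -setIA cylC (cylC (fun=> 0)) kAE; exact: IH.
move=> _ mB.
have cyl0 T' : cylinder_after T' [:: 0%R] B = [set w | B 0%R (X (T' w) w)].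
  apply/seteqP; split => w /= => [/(_ 0%R)|B0 t].
    by rewrite inE eqxx adde0 => /(_ isT).
  by rewrite inE => /eqP ->; rewrite adde0.
rewrite !cyl0 law_nu//; congr *%E.
have m0 : measurable ([set w | B 0%R (X 0 w)] : set (path_space X)).
  exact: measurable_coordinate.
rewrite completed_measureE//= /mixture.
transitivity (\int[nu]_x (\1_(B 0%R) x)%:E); first by rewrite integral_indic// setIT.
apply: eq_integral => z _; rewrite indicE.
have mz : measurable ([set w | X 0 w = z] : set (path_space X)).
  exact: (@measurable_coordinate _ _ _ X 0 [set z] (lexx _) (measurable_point _)).
have Pz := hunt_normal HX z.
have P1 : P z setT = 1 by exact: prob_kernel.
have N := negligible_not P1 mz Pz.
have [Bz|Bz] := boolP (z \in B 0%R).
  apply/eqP; rewrite eq_le; apply/andP; split.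
    rewrite -Pz; apply: le_measure; rewrite ?inE// => w /= ->; exact: set_mem.
  by rewrite -P1; apply: le_measure; rewrite ?inE.
apply/esym/negligibleP => //; apply: negligibleS N => w /= Bw Xz.
by move/negP: Bz; apply; apply: mem_set; rewrite -Xz.
Qed.

Let law_finite ts B : (forall s, s \in ts -> (0 <= s)%R) -> (forall s, measurable (B s)) ->
  Pc mu (A `&` cylinder_after T ts B) =
  Pc mu A * Pc nu (cylinder_after (fun=> 0) ts B).
Proof.
move=> ts0 mB; pose B' s := if s \in ts then B s else setT.
have cylE T' : cylinder_after T' ts B = cylinder_after T' (0%R :: sort <=%R ts) B'.
  apply/seteqP; split => w h s sts; first by rewrite /B'; case: ifPn => // /h.
  have := h s; rewrite inE mem_sort sts orbT => /(_ isT).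
  by rewrite /B' sts.
rewrite !cylE; apply: law_sorted; last by move=> s; rewrite /B'; case: ifPn.
rewrite path_sortedE; last exact: le_trans.
rewrite sort_sorted ?andbT; last exact: le_total.
by apply/allP => s; rewrite mem_sort; exact: ts0.
Qed.

Let fcyl : set (set Omega) := [set G | exists ts B,
  [/\ forall s, s \in ts -> (0 <= s)%R, forall s, measurable (B s) &
      G = cylinder_after (fun=> 0) ts B]].

Let fcylI : setI_closed fcyl.
Proof.
move=> _ _ [ts [B [ts0 mB ->]]] [ts' [B' [ts'0 mB' ->]]].
exists (ts ++ ts'), (fun s => (if s \in ts then B s else setT) `&`
  (if s \in ts' then B' s else setT)); split.
- by move=> s; rewrite mem_cat => /orP[/ts0|/ts'0].
- by move=> s; apply: measurableI; case: ifPn.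
apply/seteqP; split => [w [h h'] s _|w h].
  by split; [case: ifPn => // /h|case: ifPn => // /h'].
by split=> s sts; have := h s; rewrite mem_cat sts ?orbT => /(_ isT) [].
Qed.

Let fcyl_gen : @measurable _ (path_space X) = <<s fcyl >>.
Proof.
apply/seteqP; split.
  apply: smallest_sub; first exact: smallest_sigma_algebra.
  move=> _ [s /andP[s0 _] [B mB <-]]; have sM := smallest_sigma_algebra setT fcyl.
  case: s s0 => [s| |]// s0.
    apply: sub_sigma_algebra; exists [:: s], (fun=> B); split => //.
      by move=> r; rewrite inE => /eqP ->; rewrite -lee_fin.
    apply/seteqP; split => w /= => [Bw r|]; last by move=> /(_ s); rewrite inE add0e; exact.
    by rewrite inE => /eqP ->; rewrite add0e.
  (* At time +oo every path is at the cemetery, so this generator is trivial. *)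
  rewrite (_ : _ @^-1` _ = [set w | B None]); first exact: (sigma_const sM).
  by apply/seteqP; split => w /=; rewrite (hunt_infty HX).
apply: smallest_sub; first exact: measurable_sigma_algebra.
move=> _ [ts [B [ts0 mB ->]]]; elim/last_ind: ts ts0 => [|ts t IH] ts0.
  by rewrite (_ : cylinder_after _ _ _ = setT)//; apply/seteqP; split.
rewrite cylinder_after_rcons; apply: measurableI.
  by apply: IH => s sts; apply: ts0; rewrite mem_rcons inE sts orbT.
apply: measurable_coordinate => //; rewrite add0e lee_fin; apply: ts0.
by rewrite mem_rcons inE eqxx.
Qed.

Let shift_cylinder ts B : (forall s, s \in ts -> (0 <= s)%R) ->
  (fun w => theta (T w) w) @^-1` cylinder_after (fun=> 0) ts B = cylinder_after T ts B.
Proof.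
move=> ts0; have sh s w : s \in ts -> X (0 + s%:E) (theta (T w) w) = X (T w + s%:E) w.
  by move=> /ts0 s0; rewrite add0e (hunt_shift HX) ?lee_fin ?stT.1// addeC.
apply/seteqP; split => w h s sts; have := h s sts => /=; by rewrite sh.
Qed.

Let measurable_shift : measurable_fun setT
  (fun w : cT mu => theta (T w) w : path_space X).
Proof.
apply: (@measurability _ _ (cT mu) (path_space X) setT _ fcyl); first exact: fcyl_gen.
move=> _ [_ [ts [B [ts0 mB ->]]] <-]; rewrite setTI shift_cylinder//.
(* A time beyond all those of the cylinder: the shifted cylinder is known at T + t, hence measurable
   for the completion. *)
pose t := \big[Num.max/0%R]_(s <- ts) s.
have t0 : (0 <= t)%R.
  by rewrite /t big_seq; elim/big_ind: _ => // x y x0 y0; rewrite le_max x0.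
apply: (@stopped_measurable _ _ _ _ P (fun w => T w + t%:E)).
apply: cylinder_after_stopped => // s sts; rewrite ts0//=.
by rewrite /t; exact: le_bigmax_seq.
Qed.

(** Given A, the position at T has law [nu], so the shifted path has law P_nu. Finite cylinders form
    a pi-system generating the path space, and two finite measures that agree on it coincide. *)
Lemma strong_markov_shift (G : set Omega) : measurable (G : set (path_space X)) ->
  Pc mu (A `&` [set w | G (theta (T w) w)]) = Pc mu A * mixture P nu G.
Proof.
move=> mG; have mA : measurable (A : set (cT mu)) by exact: (stopped_measurable mu FA).
pose mf1' := isMeasurableFun.Build _ _ _ _ _ measurable_shift.
pose F : {mfun (cT mu) >-> (path_space X)} :=
  HB.pack (fun w : cT mu => theta (T w) w : path_space X) mf1'.
have := @measure_unique _ R (path_space X) fcyl (fun=> setT) fcyl_gen fcylI.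
move=> /(_ _ _ (pushforward (mrestr (Pc mu) mA) F) (mscale kA (mixture P nu))) H.
have : pushforward (mrestr (Pc mu) mA) F G = mscale kA (mixture P nu) G.
  apply: H => //.
  - by move=> _; exists [::], (fun=> setT); split => //; apply/seteqP; split.
  - by rewrite bigcup_const//; exists 0%N.
  - move=> _ [ts [B [ts0 mB ->]]]; transitivity (Pc mu
        ((fun w => theta (T w) w) @^-1` cylinder_after (fun=> 0) ts B `&` A)) => //.
    rewrite shift_cylinder// setIC law_finite// -kAE; congr *%E.
    apply: completed_measureE.
    by rewrite fcyl_gen; apply: sub_sigma_algebra; exists ts, B.
  - move=> k; rewrite /pushforward /mrestr.
    by rewrite (le_lt_trans (completed_le1 _ _))// ltry.
by rewrite /pushforward /mrestr /mscale/= kAE setIC.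
Qed.

End law_after_stopping_time.
End strong_markov.

Section almost_everywhere_predicates.
Context d (T : measurableType d) (R : realType) (mu : {measure set T -> \bar R}).
Implicit Types A B : set T.

Lemma aeS A B : A `<=` B -> {ae mu, forall w, A w} -> {ae mu, forall w, B w}.
Proof. by move=> AB; apply: filterS => w /AB. Qed.

Lemma aeI A B : {ae mu, forall w, A w} -> {ae mu, forall w, B w} ->
  {ae mu, forall w, A w /\ B w}.
Proof. by move=> Aw Bw; apply: filterS2 Aw Bw. Qed.

End almost_everywhere_predicates.

(** * Almost sure properties and Markov property from a fixed starting point *)

Section under_initial_point.
Context {R : realType} {E : set (\bar R)} {Omega : pointedType}.
Local Notation Ed := (cemetery E).
Variables (X : \bar R -> Omega -> Ed) (theta : \bar R -> Omega -> Omega).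
Variable P : R.-pker (borel_cemetery E) ~> (path_space X).
Hypothesis HX : hunt_process theta P.
Implicit Types (s t u : R) (w : Omega) (x y z : E) (b : bool) (c : \bar R).
Local Notation Pc mu := (@completed_measure_extension _ _ _ (mixture P mu)).
Local Notation start x := (\d_(Some x : borel_cemetery E) : probability (borel_cemetery E) R).

Lemma mixture_dirac x (A : set Omega) : measurable (A : set (path_space X)) ->
  mixture P (start x) A = P (Some x) A.
Proof.
move=> mA; rewrite /mixture integral_dirac//; last exact: measurable_kernel.
by rewrite diracT mul1e.
Qed.

Lemma negligible_dirac x (A : set Omega) :
  (mixture P (start x)).-negligible A <-> (P (Some x)).-negligible A.
Proof.
by split=> -[N [mN N0 AN]]; exists N; split => //; rewrite -N0 mixture_dirac.
Qed.

Lemma start_ae x : {ae P (Some x), forall w, X 0 w = Some x}.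
Proof.
have mx : measurable ([set w | X 0 w = Some x] : set (path_space X)).
  exact: (@measurable_coordinate _ _ _ X 0 [set Some x] (lexx _) (measurable_point _)).
exact: (negligible_not (prob_kernel _) mx (hunt_normal HX (Some x))).
Qed.

Lemma left_continuous_ae x b c :
  {ae P (Some x), forall w, left_continuous_at_entrance b (X^~ w) c}.
Proof.
suff : {ae mixture P (start x), forall w, left_continuous_at_entrance b (X^~ w) c}.
  by move=> /negligible_dirac.
apply: (@hunt_quasi_left_continuous _ _ _ _ _ _ HX (start x)
  (fun n => entry X b (below c n)) (entry X b c)).
- by move=> n; exact: (entry_stopping HX).
- exact: (entry_stopping HX).
- by move=> w m n mn; apply: entrance_nd; exact: below_nd.
- by move=> w; exact: (entrance_cvg (hunt_regular HX w)).
Qed.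

Hypothesis sfX : skip_free P.

Lemma adjacent_jumps_ae x : {ae P (Some x), forall w, adjacent_jumps (trajectory X w)}.
Proof.
apply: aeS (sfX x) => w sf t u v t0 Xu Xv b z uzv.
have lt : 0 < t%:E < lifetime X w.
  rewrite lte_fin t0 ltNge; apply/negP => /(hunt_absorbing HX).
  by rewrite lee_fin (ltW t0) => /(_ isT); rewrite -/(trajectory X w t) Xv.
have := sf t lt u v Xu Xv; rewrite -subset0 => /(_ (set_val z)); apply; split; last exact: set_valP.
rewrite /= gt_min lt_max; case: b uzv; rewrite /dir ?lteN2 => /andP[-> ->]; by rewrite ?orbT.
Qed.

Hypothesis nE : nearly_closed E.

Lemma value_at_entry_ae b x y : dir b x < dir b y -> {ae P (Some x), forall w,
  forall t, entry X b (dir b y) w = t%:E -> (0 < t)%R /\ X t%:E w = Some y}.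
Proof.
move=> xy.
apply: aeS (aeI (aeI (start_ae x) (adjacent_jumps_ae x)) (aeI (left_continuous_ae x b (dir b y))
  (left_continuous_ae x (~~ b) (ereal_sup (range (@dir R E (~~ b))))))).
move=> w [[X0 sf] [l1 l2]] t Dt.
exact: (value_at_entrance nE (hunt_regular HX w) sf l1 l2 X0 xy Dt).
Qed.

(** A visit to y raises the running supremum to y, so it cannot precede the entrance; conversely the
    value at the entrance is y, at a positive time as [hitting] requires. *)
Lemma hitting_entry_ae b x y : dir b x < dir b y -> {ae P (Some x), forall w,
  hitting X (Some y) w = entry X b (dir b y) w}.
Proof.
move=> xy; apply: aeS (aeI (start_ae x) (value_at_entry_ae xy)) => w [X0 val].
apply/eqP; rewrite eq_le; apply/andP; split.
  have [->|] := eqVneq (entry X b (dir b y) w) +oo; first exact: leey.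
  rewrite -ltey => /entrance_fin[t t0 Dt]; have [t0' Xt] := val _ Dt.
  by rewrite [leRHS]Dt; apply: ereal_inf_lbound.
apply: le_ereal_inf_tmp => -[t| |] [// t0 Xt]; last by rewrite (hunt_infty HX) in Xt.
rewrite lte_fin in t0.
apply: ereal_inf_lbound; exists t => //; split; first exact: ltW.
by apply: runsup_ge Xt; rewrite ?(ltW t0) ?lexx// /trajectory X0.
Qed.

Section markov_at_a_point.
Variables (x : E) (T : Omega -> \bar R) (A : set Omega).
Hypotheses (stT : stopping_time P T) (FA : stopped_filtration P T A).
Hypothesis mA : measurable (A : set (path_space X)).

Let PcE (B : set Omega) : measurable (B : set (path_space X)) ->
  Pc (start x) B = P (Some x) B.
Proof. by move=> mB; rewrite -mixture_dirac//; apply: completed_measureE. Qed.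

Let toM (Q : set Omega) :
  {ae P (Some x), forall w, Q w} -> {ae mixture P (start x), forall w, Q w}.
Proof. by move=> /negligible_dirac. Qed.

Let markov_point y (G : set Omega) : measurable (G : set (path_space X)) ->
  {ae P (Some x), forall w, A w -> X (T w) w = Some y} ->
  Pc (start x) (A `&` [set w | G (theta (T w) w)]) = P (Some x) A * P (Some y) G.
Proof.
move=> mG XT; rewrite -PcE// -mixture_dirac//.
apply: (@strong_markov_shift _ _ _ _ theta) => // B mB.
rewrite [X in _ * X](_ : _ = ((Some y : borel_cemetery E) \in B)%:R%:E); last exact: diracE.
have [By|By] := boolP ((Some y : borel_cemetery E) \in B).
  rewrite mule1; apply/completed_ae_eq/toM; apply: aeS XT => w XT.
  by split=> [[]//|Aw]; split => //=; rewrite XT//; exact: set_mem.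
rewrite mule0; apply: completed_negligible; apply/negligible_dirac.
apply: negligibleS XT => w [Aw /= Bw] /(_ Aw) XT.
by move/negP: By; apply; apply: mem_set; rewrite -XT.
Qed.

(** On A the position at T is deterministic. The event is passed as a measurable [H] equal to it
    almost surely, because the preimage of G by the shift is measurable only after completion. *)
Lemma strong_markov_point y (G H : set Omega) :
  measurable (G : set (path_space X)) -> measurable (H : set (path_space X)) ->
  {ae P (Some x), forall w, A w -> X (T w) w = Some y} ->
  {ae P (Some x), forall w, H w <-> A w /\ G (theta (T w) w)} ->
  P (Some x) H = P (Some x) A * P (Some y) G.
Proof.
move=> mG mH XT HAG; rewrite -markov_point// -PcE//.
exact/completed_ae_eq/toM.
Qed.

Lemma strong_markov_point_le y (G H : set Omega) :
  measurable (G : set (path_space X)) -> measurable (H : set (path_space X)) ->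
  {ae P (Some x), forall w, A w -> X (T w) w = Some y} ->
  {ae P (Some x), forall w, H w -> A w /\ G (theta (T w) w)} ->
  P (Some x) H <= P (Some x) A * P (Some y) G.
Proof.
move=> mG mH XT HAG; rewrite -markov_point// -PcE//.
exact/completed_ae_le/toM.
Qed.

End markov_at_a_point.

(** The Markov property at a fixed time when the position is only known to lie in [K]: the law of
    X_u given A is carried by K, and P_q(G) is integrated against it. *)
Lemma markov_bound x u (A G H : set Omega) (K : set (borel_cemetery E)) (c : \bar R) :
  (0 <= u)%R -> filtration P u%:E A ->
  measurable (A : set (path_space X)) -> measurable (G : set (path_space X)) ->
  measurable (H : set (path_space X)) -> measurable K -> 0 <= c ->
  (forall w, A w -> K (X u%:E w)) -> (forall q : borel_cemetery E, K q -> P q G <= c) ->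
  (forall w, H w -> A w /\ G (theta u%:E w)) ->
  P (Some x) H <= c * P (Some x) A.
Proof.
move=> u0 FA mA mG mH mK c0 AK Gc HAG.
have [A0|A0] := eqVneq (P (Some x) A) 0.
  rewrite A0 mule0 -A0; apply: le_measure; rewrite ?inE//.
  by move=> w /HAG[].
have mXu : measurable_fun setT (X u%:E : path_space X -> borel_cemetery E).
  by move=> _ B mB; rewrite setTI; apply: measurable_coordinate => //; rewrite lee_fin.
have [rho rhoE] : exists rho : {measure set (borel_cemetery E) -> \bar R},
    forall B, rho B = P (Some x) (A `&` [set w | B (X u%:E w)]).
  unshelve eexists (pushforward (mrestr (P (Some x)) mA)
    (X u%:E : path_space X -> borel_cemetery E) : {measure set _ -> \bar R}).
    exact: mXu.
  by move=> B; rewrite /= /pushforward /mrestr setIC.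
(* The conditional law of X_u given A; [start x] is the default value of the normalisation, excluded
   since the mass is positive and finite. *)
pose nu : probability (borel_cemetery E) R := mnormalize rho (start x).
have rhoT : rho setT = P (Some x) A.
  by rewrite rhoE; congr (P (Some x) _); apply/seteqP; split => w //= [].
have A1 : P (Some x) A <= 1.
  by rewrite -(prob_kernel (s := P) (Some x)); apply: le_measure; rewrite ?inE.
have Aoo : P (Some x) A \is a fin_num by rewrite ge0_fin_numE// (le_lt_trans A1)// ltry.
have nuE B : nu B = rho B * (fine (P (Some x) A))^-1%:E.
  rewrite /nu/= /mnormalize rhoT (negbTE A0)/=.
  by rewrite (negbTE (_ : P (Some x) A != +oo)) //; case: (P (Some x) A) Aoo.
have PcE (B : set Omega) : measurable (B : set (path_space X)) ->
    Pc (start x) B = P (Some x) B.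
  by move=> mB; rewrite -mixture_dirac//; apply: completed_measureE.
have := @strong_markov_shift _ _ _ X theta P HX (start x) nu (fun=> u%:E) A (cst_stopping P u0).
move=> /(_ _ _ G mG) SM.
apply: (@le_trans _ _ (Pc (start x) (A `&` [set w | G (theta u%:E w)]))).
  by rewrite -PcE//; apply: (@completed_measure_mono _ (path_space X)) => w /HAG.
rewrite SM; last 2 first.
- move=> t t0; have sF := filtration_sigma_algebra P t.
  have [ut|ut] := boolP (u%:E <= t).
    rewrite (_ : [set w | true] = setT) ?setIT; last by apply/seteqP; split.
    exact: (filtration_nd ut).
  rewrite [X in filtration P t X](_ : _ = [set w | False]); first exact: (sigma_const sF).
  by apply/seteqP; split => w // [].
- move=> B mB; rewrite !PcE//; last first.
    by apply: measurableI => //; apply: measurable_coordinate => //; rewrite lee_fin.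
  rewrite nuE rhoE muleCA -[X in _ * (X * _)](fineK Aoo) -EFinM divff ?mule1//.
  by rewrite fine_eq0.
rewrite PcE// muleC; apply: lee_wpmul2r => //.
have nuK : nu (~` K) = 0.
  rewrite nuE rhoE (_ : A `&` _ = set0) ?measure0 ?mul0e//.
  by apply/seteqP; split => w // [/AK].
rewrite /mixture -(setUCr K) (ge0_integral_setU _ mK (measurableC mK)); last 3 first.
- by rewrite setUCr; exact: measurable_kernel.
- by move=> z _; exact: measure_ge0.
- exact/disj_setPCl.
rewrite [X in _ + X]null_set_integral ?adde0//; last 2 first.
- exact: measurableC.
- by apply: measurable_funTS; exact: measurable_kernel.
apply: (@le_trans _ _ (\int[nu]_(z in K) cst c z)).
  apply: ge0_le_integral => //.
  by apply: measurable_funTS; exact: measurable_kernel.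
rewrite integral_cst// -[leRHS]mule1; apply: lee_wpmul2l => //.
exact: probability_le1.
Qed.

End under_initial_point.

(** * Exit probabilities *)

Section stopped_comparisons.
Context {R : realType} {E : set (\bar R)} {Omega : pointedType}.
Local Notation Ed := (cemetery E).
Variables (X : \bar R -> Omega -> Ed).
Variable P : R.-pker (borel_cemetery E) ~> (path_space X).
Variables (T T' : Omega -> \bar R).
Hypotheses (stT : stopping_time P T) (stT' : stopping_time P T').

Lemma stopped_lt : stopped_filtration P T [set w | T w < T' w].
Proof.
move=> t t0; have sF := filtration_sigma_algebra P t.
rewrite [X in filtration P t X](_ : _ = [set w | T w <= t /\ (~ (T' w <= t) \/
    exists q : rat, (ratr q)%:E <= t /\ (T w <= (ratr q)%:E /\ ~ (T' w <= (ratr q)%:E)))]).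
  apply: (sigma_and sF); first exact: stT.2.
  apply: (sigma_or sF); first by apply: (sigma_not sF); exact: stT'.2.
  apply: (sigma_exists sF) => q; have [qt|qt] := boolP ((ratr q)%:E <= t).
    apply: (sigma_and sF); first exact: (sigma_const sF).
    apply: (sigma_and sF); first exact: (stopping_le stT).
    by apply: (sigma_not sF); exact: (stopping_le stT').
  rewrite [X in filtration P t X](_ : _ = [set w | False]); first exact: (sigma_const sF).
  by apply/seteqP; split => w //= [].
apply/seteqP; split => w /=.
  move=> [TT' Tt]; split => //; have [T't|T't] := leP (T' w) t; last by left.
  right; have [q Tq qT'] := ereal_rat_dense TT'; exists q; split.
    exact: le_trans (ltW qT') T't.
  by split; [exact: ltW|apply/negP; rewrite -ltNge].
move=> [Tt [/negP|[q [_ [Tq /negP]]]]]; rewrite -ltNge => lt; split => //.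
  exact: le_lt_trans lt.
exact: le_lt_trans lt.
Qed.

Lemma stopped_le s : stopped_filtration P T [set w | T w <= s%:E].
Proof.
move=> t t0; have sF := filtration_sigma_algebra P t.
have [st|ts] := leP s%:E t.
  rewrite [X in filtration P t X](_ : _ = [set w | T w <= s%:E]).
    exact: (stopping_le stT).
  by apply/seteqP; split => w /=; [case|move=> Ts; split => //; exact: le_trans st].
rewrite [X in filtration P t X](_ : _ = [set w | T w <= t]); first exact: stT.2.
by apply/seteqP; split => w /=; [case|move=> Tt; split => //; exact: le_trans (ltW ts)].
Qed.

End stopped_comparisons.

Section skip_free_hunt_processes.
Context {R : realType} {E : set (\bar R)} {Omega : pointedType}.
Local Notation Ed := (cemetery E).
Variables (X : \bar R -> Omega -> Ed) (theta : \bar R -> Omega -> Omega).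
Variable P : R.-pker (borel_cemetery E) ~> (path_space X).
Hypotheses (nE : nearly_closed E) (sfhX : skip_free_hunt theta P).
Implicit Types (s t u : R) (w : Omega) (a x y z : E) (b : bool) (c : \bar R).

Let HX : hunt_process theta P. Proof. by case: sfhX. Qed.
Let sfX : skip_free P. Proof. by case: sfhX. Qed.
Let regX : forall w, regular_path (trajectory X w) := hunt_regular HX.

Definition up b y : Omega -> \bar R := entry X b (dir b y).

Definition exits_up b a y : set Omega := [set w | up b y w < up (~~ b) a w].

Let mup b y t : measurable ([set w | up b y w <= t%:E] : set (path_space X)).
Proof. exact: (measurable_entry_le regX). Qed.

Let mexits b a y : measurable (exits_up b a y : set (path_space X)).
Proof. exact: (measurable_entry_lt regX). Qed.

Let stup b y : stopping_time P (up b y) := entry_stopping HX b (dir b y).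

Let sM := measurable_sigma_algebra (path_space X).

Let P_le1 q (A : set Omega) : measurable (A : set (path_space X)) -> P q A <= 1.
Proof.
move=> mA; rewrite -(prob_kernel (s := P) q).
by apply: le_measure; rewrite ?inE.
Qed.

Let P_fin q (A : set Omega) : measurable (A : set (path_space X)) -> P q A \is a fin_num.
Proof. by move=> mA; rewrite ge0_fin_numE// (le_lt_trans (P_le1 q mA))// ltry. Qed.

Let up_value x b y : dir b x < dir b y -> {ae P (Some x), forall w,
  forall t, up b y w = t%:E -> (0 < t)%R /\ X t%:E w = Some y}.
Proof. exact: (value_at_entry_ae HX sfX nE). Qed.

Lemma entry_theta b c w t : (0 <= t)%R -> X 0 w <> None -> X t%:E w <> None ->
  t%:E < entry X b c w -> entry X b c w = entry X b c (theta t%:E w) + t%:E.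
Proof.
move=> t0 X0 Xt tc.
rewrite /entry (entrance_shift (regX w) X0 Xt t0); last by rewrite -entrance_gt.
congr (_ + _); apply: eq_entrance => s s0.
by rewrite /trajectory (hunt_shift HX) ?lee_fin.
Qed.

Let up_theta b y w t : (0 <= t)%R -> X 0 w <> None -> X t%:E w <> None ->
  t%:E < up b y w -> up b y w = up b y (theta t%:E w) + t%:E.
Proof. exact: entry_theta. Qed.

Let up_fin b y w c : up b y w < c -> exists2 t, (0 <= t)%R & up b y w = t%:E.
Proof. by move=> lt; apply: entrance_fin; rewrite (lt_le_trans lt)// leey. Qed.

Let up_nd b y z w : dir b y <= dir b z -> up b y w <= up b z w.
Proof. exact: entrance_nd. Qed.

(** Reaching z before a from x forces a passage at y before a, from where the path starts afresh. *)
Lemma exits_up_mul b a x y z :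
  dir b a < dir b x -> dir b x < dir b y -> dir b y < dir b z ->
  P (Some x) (exits_up b a z) = P (Some x) (exits_up b a y) * P (Some y) (exits_up b a z).
Proof.
move=> ax xy yz.
have xz := lt_trans xy yz.
apply: (@strong_markov_point _ _ _ X theta P HX x (up b y)) => //.
- exact: stopped_lt.
- apply: aeS (up_value xy) => w val /up_fin[t t0 Dt].
  by rewrite Dt; have [] := val _ Dt.
apply: aeS (aeI (start_ae HX x) (aeI (up_value xy) (up_value xz))) => w [X0 [vy vz]].
suff key : exits_up b a y w -> (exits_up b a z w <-> exits_up b a z (theta (up b y w) w)).
  split=> [zw|[yw zw]]; last exact/key.
  have yw : exits_up b a y w by apply: le_lt_trans zw; exact/up_nd/ltW.
  by split => //; exact/key.
move=> yw; have [t t0 Dy] := up_fin yw; rewrite Dy.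
have [t0' Xt] := vy _ Dy.
have X0' : X 0 w <> None by rewrite X0.
have Xt' : X t%:E w <> None by rewrite Xt.
have ta : t%:E < up (~~ b) a w by rewrite -Dy.
(* The entrance times of y and z differ, as the path cannot be at both points. *)
have tz : t%:E < up b z w.
  rewrite lt_neqAle -Dy up_nd ?ltW// andbT; apply/eqP => Dyz.
  have [_] := vz t (etrans (esym Dyz) Dy).
  by rewrite Xt => -[yz']; move: yz; rewrite yz' ltxx.
rewrite /exits_up/= (up_theta t0 X0' Xt' tz) (up_theta t0 X0' Xt' ta).
by rewrite lteD2rE.
Qed.

(** Starting from a the path meets x first, and the time left from x to y is at most the total
    time. *)
Lemma up_le_mono b a x y t : dir b a < dir b x -> dir b x < dir b y ->
  P (Some a) [set w | up b y w <= t%:E] <= P (Some x) [set w | up b y w <= t%:E].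
Proof.
move=> ax xy; have ay := lt_trans ax xy.
apply: (@le_trans _ _ (P (Some a) [set w | up b x w <= t%:E] *
    P (Some x) [set w | up b y w <= t%:E])); last first.
  by rewrite -[leRHS]mul1e; apply: lee_wpmul2r => //; exact: P_le1.
apply: (@strong_markov_point_le _ _ _ X theta P HX a (up b x)) => //.
- exact: stopped_le.
- apply: aeS (up_value ax) => w val /= xt.
  have [r r0 Dr] : exists2 r, (0 <= r)%R & up b x w = r%:E.
    by apply: entrance_fin; rewrite (le_lt_trans xt)// ltry.
  by rewrite Dr; have [] := val _ Dr.
apply: aeS (aeI (start_ae HX a) (aeI (up_value ax) (up_value ay))) => w [X0 [vx vy]] /= yt.
have xt : up b x w <= t%:E by apply: le_trans yt; exact/up_nd/ltW.
split => //.
have [r r0 Dr] : exists2 r, (0 <= r)%R & up b x w = r%:E.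
  by apply: entrance_fin; rewrite (le_lt_trans xt)// ltry.
have [r0' Xr] := vx _ Dr.
have X0' : X 0 w <> None by rewrite X0.
have Xr' : X r%:E w <> None by rewrite Xr.
have ry : r%:E < up b y w.
  rewrite lt_neqAle -Dr up_nd ?ltW// andbT; apply/eqP => Dxy.
  have [_] := vy r (etrans (esym Dxy) Dr).
  by rewrite Xr => -[xy']; move: xy; rewrite xy' ltxx.
rewrite Dr; apply: le_trans yt; rewrite (up_theta r0 X0' Xr' ry).
by rewrite leeDl// lee_fin.
Qed.

Lemma up_reached x b y : dir b x < dir b y ->
  exists n : nat, 0 < P (Some x) [set w | up b y w <= n%:R%:E].
Proof.
move=> xy; have [_ _ reg _] := sfhX; have := reg x y.
apply: contraPP => /forallNP nreg; apply/negP; rewrite -leNgt.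
have mfin : measurable ([set w | exists n : nat, up b y w <= n%:R%:E] : set (path_space X)).
  by apply: (sigma_exists sM) => n; exact: mup.
rewrite (@completed_ae_eq _ (path_space X) _ (P (Some x)) _
    [set w | exists n : nat, up b y w <= n%:R%:E]).
  rewrite completed_negligible//; apply: negligible_exists => n.
  apply/negligibleP; first exact: mup.
  apply/eqP; rewrite eq_le measure_ge0 andbT leNgt.
  exact/negP/nreg.
apply: aeS (hitting_entry_ae HX sfX nE xy) => w /= ->; split.
  move=> /entrance_fin[t t0 Dt]; exists (Num.bound t); rewrite /up /entry Dt lee_fin ltW//.
  exact: unstable.ltr_bound.
by move=> [n Dn]; rewrite (le_lt_trans Dn)// ltry.
Qed.

Let up_pos x b y : dir b x < dir b y -> {ae P (Some x), forall w, 0 < up b y w}.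
Proof.
move=> xy; apply: aeS (up_value xy) => w val.
rewrite lt_neqAle entrance_ge0 andbT; apply/eqP => D0.
by have [] := val 0%R (esym D0); rewrite ltxx.
Qed.

Let up_neq x b b' y z : dir b x < dir b y -> dir b' x < dir b' z -> y <> z ->
  {ae P (Some x), forall w, forall t, up b y w = t%:E -> up b' z w <> t%:E}.
Proof.
move=> xy xz yz; apply: aeS (aeI (up_value xy) (up_value xz)) => w [vy vz] t Dy Dz.
by have [_] := vy _ Dy; have [_ ->] := vz _ Dz => -[zy]; apply: yz.
Qed.

(* If y cannot be reached before a, then reaching y from x requires to wait first
   for a, and the time needed to go from a to y dominates the one from x. *)
Lemma exits_up_gt0 b a x y : dir b a < dir b x -> dir b x < dir b y ->
  0 < P (Some x) (exits_up b a y).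
Proof.
move=> ax xy; rewrite lt_neqAle measure_ge0 andbT eq_sym; apply/eqP => exit0.
have xa : dir (~~ b) x < dir (~~ b) a by rewrite dir_ltN.
have ya : y <> a by move=> ya; move: (lt_trans ax xy); rewrite ya ltxx.
(* The entrance time of a is almost surely positive, so it exceeds some short delay with positive
   probability. *)
have [k kP] : exists k : nat, P (Some x) [set w | up (~~ b) a w <= k.+1%:R^-1%:E] < 1.
  apply: contrapT => /forallNP h.
  have full k : (P (Some x)).-negligible [set w | ~ (up (~~ b) a w <= k.+1%:R^-1%:E)].
    apply: (negligible_not (prob_kernel _) (mup _ _ _)); apply/eqP.
    by rewrite eq_le P_le1// leNgt; exact/negP/h.
  have := negligible_exists full.
  have := up_pos xa.
  move=> n1 n2; have : (P (Some x)).-negligible [set: path_space X].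
    apply: negligibleS (negligibleU n1 n2) => w _.
    have [Dpos|] := pselect (0 < up (~~ b) a w); last by left.
    right => /=; have [->|] := eqVneq (up (~~ b) a w) +oo.
      by exists 0%N; apply/negP; rewrite -ltNge ltry.
    rewrite -ltey => /up_fin[t t0 Dt]; move: Dpos; rewrite Dt lte_fin => Dpos.
    have [k] := ltr_add_invr Dpos; rewrite add0r => kt.
    by exists k; apply/negP; rewrite lee_fin -ltNge.
  move=> /negligibleP => /(_ measurableT); rewrite [LHS](prob_kernel (s := P) (Some x)).
  exact/eqP/onee_neq0.
pose e : R := (k.+1%:R^-1)%R.
have e0 : (0 < e)%R by rewrite invr_gt0.
(* Induction in steps of length [e]: the time n amounts to n * k.+1 of them. *)
suff zero j : P (Some x) [set w | up b y w <= (j%:R * e)%:E] = 0.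
  have [n] := up_reached xy; rewrite lt_neqAle => /andP[/eqP + _]; apply; apply/esym/eqP.
  rewrite eq_le measure_ge0 andbT -(zero (n * k.+1)%N).
  apply: le_measure; rewrite ?inE// => w /= Dn; rewrite (le_trans Dn)// lee_fin.
  by rewrite natrM -mulrA divff ?mulr1.
elim: j => [|j IH].
  apply/negligibleP; first exact: mup.
  apply: negligibleS (up_pos xy) => w /=; rewrite mul0r => D0 Dpos.
  by move: D0; rewrite leNgt Dpos.
pose H := [set w | up b y w <= (j.+1%:R * e)%:E].
pose H1 := [set w | H w /\ up (~~ b) a w <= e%:E].
pose H2 := [set w | H w /\ ~ (up (~~ b) a w <= e%:E)].
have mH : measurable (H : set (path_space X)) by exact: mup.
have mH1 : measurable (H1 : set (path_space X)).
  by apply: (sigma_and sM) => //; exact: mup.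
have mH2 : measurable (H2 : set (path_space X)).
  by apply: (sigma_and sM) => //; apply: (sigma_not sM); exact: mup.
have ge_a : {ae P (Some x), forall w, ~ exits_up b a y w}.
  have : (P (Some x)).-negligible (exits_up b a y) by apply/negligibleP.
  by apply: negligibleS => w /=; rewrite notK.
have after w : X 0 w = Some x -> ~ exits_up b a y w -> H w ->
    (forall t, up (~~ b) a w = t%:E -> (0 < t)%R /\ X t%:E w = Some a) ->
    (forall t, up b y w = t%:E -> up (~~ b) a w <> t%:E) ->
    exists r, [/\ up (~~ b) a w = r%:E, (0 <= r)%R & up b y w = up b y (theta r%:E w) + r%:E].
  move=> X0 /negP; rewrite -leNgt => ay Hw va neq.
  have [r r0 Dr] : exists2 r, (0 <= r)%R & up (~~ b) a w = r%:E.
    by apply: entrance_fin; rewrite (le_lt_trans ay)// (le_lt_trans Hw)// ltry.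
  exists r; split => //; apply: up_theta => //; first by rewrite X0.
    by have [_ ->] := va _ Dr.
  rewrite lt_neqAle -Dr ay andbT; apply/eqP => Dry.
  by apply: (neq r) => //; rewrite -Dry.
have ae_all := aeI (aeI (start_ae HX x) ge_a) (aeI (up_value xa) (up_neq xy xa ya)).
have XTa t : {ae P (Some x), forall w, up (~~ b) a w <= t%:E -> X (up (~~ b) a w) w = Some a}.
  apply: aeS (up_value xa) => w va at_.
  have [r r0 Dr] : exists2 r, (0 <= r)%R & up (~~ b) a w = r%:E.
    by apply: entrance_fin; rewrite (le_lt_trans at_)// ltry.
  by rewrite Dr; have [] := va _ Dr.
(* When a is entered by time [e], the path from a is granted the whole time allowance again, and
   starting from a is then no better than starting from x. *)
have le1 : P (Some x) H1 <= P (Some x) [set w | up (~~ b) a w <= e%:E] * P (Some x) H.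
  apply: (@le_trans _ _ (P (Some x) [set w | up (~~ b) a w <= e%:E] * P (Some a) H)).
    apply: (@strong_markov_point_le _ _ _ X theta P HX x (up (~~ b) a)) => //.
    - exact: stopped_le.
    - exact: XTa.
    apply: aeS ae_all => w [[X0 nex] [va neq]] [Hw ae].
    have [r [Dr r0 Dy]] := after _ X0 nex Hw va neq.
    split => //; rewrite Dr; apply: le_trans Hw; rewrite Dy.
    by rewrite leeDl// lee_fin.
  by apply: lee_wpmul2l => //; exact: up_le_mono.
(* When a is entered after [e], at most j steps remain, and the induction hypothesis gives zero. *)
have le2 : P (Some x) H2 <= 0.
  apply: (@le_trans _ _ (P (Some x) [set w | up (~~ b) a w <= (j.+1%:R * e)%:E] *
      P (Some a) [set w | up b y w <= (j%:R * e)%:E])).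
    apply: (@strong_markov_point_le _ _ _ X theta P HX x (up (~~ b) a)) => //.
    - exact: stopped_le.
    - exact: XTa.
    apply: aeS ae_all => w [[X0 nex] [va neq]] [Hw /negP]; rewrite -ltNge => ea.
    have [r [Dr r0 Dy]] := after _ X0 nex Hw va neq.
    split; first by apply: le_trans Hw; rewrite leNgt; exact/negP.
    move: Hw ea; rewrite /H/= Dr Dy -leeBrDr// -EFinB lte_fin => Hw er.
    apply: (le_trans Hw); rewrite lee_fin -natr1 mulrDl mul1r -addrA gerDl.
    by rewrite subr_le0 ltW.
  have := up_le_mono (j%:R * e) ax xy; rewrite IH => le0.
  by apply: mule_ge0_le0.
(* This has the form h <= r h with r < 1, whence h = 0. *)
have HE : P (Some x) H <= P (Some x) [set w | up (~~ b) a w <= e%:E] * P (Some x) H.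
  apply: (@le_trans _ _ (P (Some x) (H1 `|` H2))).
    apply: le_measure; rewrite ?inE//; first exact: measurableU.
    by move=> w Hw; have [?|?] := pselect (up (~~ b) a w <= e%:E); [left|right].
  apply: le_trans (measureU2 _ mH1 mH2) _.
  by rewrite -[leRHS]adde0; exact: leeD.
apply/eqP; rewrite eq_le measure_ge0 andbT.
move: HE kP; rewrite -/e.
have := P_fin (Some x) mH; have := P_fin (Some x) (mup (~~ b) a e).
have := measure_ge0 (P (Some x)) H.
case: (P (Some x) [set w | up (~~ b) a w <= e%:E]) => [r| |]//.
case: (P (Some x) H) => [h| |]//; rewrite -EFinM !lee_fin lte_fin => h0 _ _ hr r1.
rewrite leNgt; apply/negP => h0'; move: hr; rewrite leNgt => /negP; apply.
by rewrite gtr_pMl.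
Qed.

(* The event of the killing condition need not be measurable; it is included in
   the measurable event below, which has the same probability. *)
Let dies_outside b a y : set Omega := [set w | exists p : rat, (0 < (ratr p : R))%R /\
  (X (ratr p)%:E w <> None /\ ((exists n : nat, X n.+1%:R%:E w = None) /\
  forall q : rat, (ratr p <= (ratr q : R))%R ->
    ~ (ray b (dir b a) (X (ratr q)%:E w) /\ ray (~~ b) (dir (~~ b) y) (X (ratr q)%:E w))))].

(** At a finite lifetime the left limit is the cemetery, near which the path avoids the segment from
    a to y; a path that has not left ]a,y[ therefore cannot have died. *)
Lemma alive_before_exit_ae b a x y : dir b a < dir b x -> dir b x < dir b y ->
  {ae P (Some x), forall w, forall t, (0 <= t)%R ->
    t%:E < up b y w -> t%:E < up (~~ b) a w -> X t%:E w <> None}.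
Proof.
move=> ax xy.
pose dead : set Omega := [set w | exists n : nat, X n.+1%:R%:E w = None].
have mX q B : (0 <= q)%R -> measurable (B : set (borel_cemetery E)) ->
    measurable ([set w | B (X q%:E w)] : set (path_space X)).
  by move=> q0; apply: measurable_coordinate; rewrite lee_fin.
have mdead : measurable (dead : set (path_space X)).
  by apply: (sigma_exists sM) => n; apply: (mX _ [set None]) => //; exact: measurable_cemetery.
have mout : measurable (dies_outside b a y : set (path_space X)).
  apply: (sigma_exists sM) => p; have [p0|p0] := boolP (0 < (ratr p : R))%R; last first.
    rewrite [X in measurable X](_ : _ = [set w | False]); first exact: (sigma_const sM).
    by apply/seteqP; split => w //= [].
  apply: (sigma_and sM); first exact: (sigma_const sM).
  apply: (sigma_and sM).
    apply: (sigma_not sM); apply: (mX _ [set None]); first exact: ltW.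
    exact: measurable_cemetery.
  apply: (sigma_and sM) => //; apply: (sigma_forall sM) => q.
  have [pq|pq] := boolP (ratr p <= (ratr q : R))%R; last first.
    rewrite [X in measurable X](_ : _ = [set w | True]); first exact: (sigma_const sM).
    by apply/seteqP; split => w.
  apply: (sigma_imply sM); first exact: (sigma_const sM).
  have q0 : (0 <= (ratr q : R))%R by rewrite (le_trans (ltW p0)).
  apply: (sigma_not sM); apply: (sigma_and sM); apply: mX => //; exact: measurable_ray.
have deadE : dead = [set w | lifetime X w < +oo].
  apply/seteqP; split => w /=.
    move=> [n Xn]; apply: (@le_lt_trans _ _ n.+1%:R%:E); last by rewrite ltry.
    by apply: ereal_inf_lbound.
  move=> /ereal_inf_lt[[t| |] [t0 Xt] //= _]; exists (Num.bound t).
  have tb := unstable.ltr_bound t; rewrite lte_fin in t0.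
  apply: (path_absorbed (regX w) t0 _ Xt).
  by rewrite (le_trans (ltW tb))// ler_nat.
have killed : {ae P (Some x), forall w, dead w -> dies_outside b a y w}.
  have outdead : dies_outside b a y `<=` dead by move=> w [p [_ [_ []]]].
  (* The killing condition speaks only when death has positive probability. *)
  have [dead0|dead_gt] := eqVneq (P (Some x) dead) 0.
    have : (P (Some x)).-negligible dead by apply/negligibleP.
    by apply: negligibleS => w /=; apply: contra_notP => + /[dup].
  have [_ _ _ /(_ x)] := sfhX; rewrite -deadE.
  rewrite [X in 0 < X](completed_measureE (P (Some x)) mdead).
  rewrite lt_neqAle measure_ge0 eq_sym dead_gt => /(_ isT)[_ kill].
  have Peq : P (Some x) (dies_outside b a y) = P (Some x) dead.
    apply/eqP; rewrite eq_le; apply/andP; split; first by apply: le_measure; rewrite ?inE.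
    rewrite -(completed_measureE (P (Some x)) mdead) -kill -(completed_measureE (P (Some x)) mout).
    apply: (@completed_measure_mono _ (path_space X)) => w [t [t0 life Xt]].
    rewrite lte_fin in t0.
    have [d /= d0 dX] : \forall s \near t^'-, forall e, X s%:E w = Some e ->
        ~ (dir b a <= dir b e <= dir b y).
      exact: Xt _ (near_cemetery nE b a y).
    (* A rational time before death from which on the path avoids the segment. *)
    have /rat_in_itvoo[p] : (Num.max 0 (t - d) < t)%R by rewrite gt_max t0 gtrDl oppr_lt0.
    rewrite in_itv/= gt_max => /andP[/andP[p0 dp] pt].
    have alive s : (0 < s)%R -> (s < t)%R -> X s%:E w <> None.
      move=> s0 st Xs; have : lifetime X w <= s%:E by apply: ereal_inf_lbound.
      by rewrite life lee_fin leNgt st.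
    have gone s : (t <= s)%R -> X s%:E w = None.
      move=> ts; apply: (hunt_absorbing HX); first by rewrite lee_fin (le_trans (ltW t0)).
      by rewrite life lee_fin.
    exists p; split => //; split; first exact: alive.
    split.
      exists (Num.bound t); apply: gone; rewrite (le_trans (ltW (unstable.ltr_bound t)))//.
      by rewrite ler_nat.
    move=> q pq [[e Xe ae] [e' Xe' ey]]; have [tq|qt] := leP t (ratr q).
      by rewrite gone in Xe.
    apply: (dX (ratr q) _ qt e Xe).
      rewrite /= ger0_norm ?subr_ge0 ?(ltW qt)// ltrBlDl -ltrBlDr.
      by rewrite (lt_le_trans dp).
    move: Xe' ey; rewrite Xe => -[<-]; rewrite dir_ltN => ey.
    by rewrite (ltW ae) (ltW ey).
  have : (P (Some x)).-negligible (dead `\` dies_outside b a y).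
    apply/negligibleP; first exact: measurableD.
    rewrite measureD//; last by rewrite -ge0_fin_numE//; exact: P_fin.
    by rewrite (setIidr outdead) [X in _ - X]Peq subee// P_fin.
  by apply: negligibleS => w /= /not_implyP.
apply: aeS (aeI (start_ae HX x) killed) => w [X0 out] t t0 ty ta Xt.
have X0' : X 0 w <> None by rewrite X0.
have tpos : (0 < t)%R.
  by rewrite lt_neqAle t0 andbT; apply/eqP => t00; move: Xt; rewrite -t00.
have [|p [p0 [Xp [_ nray]]]] := out.
  exists (Num.bound t); apply: (path_absorbed (regX w) tpos _ Xt).
  by rewrite (le_trans (ltW (unstable.ltr_bound t)))// ler_nat.
have pt : (ratr p < t)%R.
  rewrite ltNge; apply/negP => tp; apply: Xp.
  exact: (path_absorbed (regX w) tpos tp Xt).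
case Xe : (X (ratr p)%:E w) => [e|]; last by [].
(* Taken at q = p: before the exit the running suprema in both directions keep X_p strictly between
   a and y. *)
apply: (nray p (lexx _)); rewrite Xe; split.
  exists e => //; rewrite -dir_ltN; apply: le_lt_trans (_ : runsup (~~ b) (trajectory X w) t < _).
    by apply: (runsup_ge _ X0' _ Xe); rewrite (ltW p0) ltW.
  by rewrite -entrance_gt.
exists e => //; rewrite dir_ltN; apply: le_lt_trans (_ : runsup b (trajectory X w) t < _).
  by apply: (runsup_ge _ X0' _ Xe); rewrite (ltW p0) ltW.
by rewrite -entrance_gt.
Qed.

(** A contraction: with m the supremum over ]a,y[ of the probability of never leaving, the Markov
    property at time n gives m <= m (1 - delta). Here delta > 0 is the probability to go from a to y
    by time n, a lower bound for the same probability from all points between. *)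
Lemma exits_ae b a x y : dir b a < dir b x -> dir b x < dir b y ->
  {ae P (Some x), forall w, ~ (up b y w = +oo /\ up (~~ b) a w = +oo)}.
Proof.
pose I : set Omega := [set w | up b y w = +oo /\ up (~~ b) a w = +oo].
have mI : measurable (I : set (path_space X)).
  rewrite (_ : I = [set w | forall n : nat,
      ~ (up b y w <= n%:R%:E) /\ ~ (up (~~ b) a w <= n%:R%:E)]).
    apply: (sigma_forall sM) => n; apply: (sigma_and sM); apply: (sigma_not sM); exact: mup.
  have inf b' z w : (forall n : nat, ~ (up b' z w <= n%:R%:E)) -> up b' z w = +oo.
    move=> h; apply/eqP; rewrite -leye_eq leNgt; apply/negP => /up_fin[t t0 Dt].
    apply: (h (Num.bound t)); rewrite Dt lee_fin ltW//; exact: unstable.ltr_bound.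
  apply/seteqP; split => w /=; first by move=> [-> ->] n; rewrite leye_eq.
  by move=> h; split; apply: inf => n; have [] := h n.
suff I0 x0 : dir b a < dir b x0 -> dir b x0 < dir b y -> P (Some x0) I = 0.
  move=> ax xy; have : (P (Some x)).-negligible I by apply/negligibleP; [exact: mI|exact: I0].
  by apply: negligibleS => w /=; rewrite notK.
pose between : set E := [set z : E | dir b a < dir b z /\ dir b z < dir b y].
pose m := ereal_sup [set P (Some z) I | z in between].
move=> ax0 x0y; have ay := lt_trans ax0 x0y.
have [n nP] := up_reached ay.
pose delta := P (Some a) [set w | up b y w <= n%:R%:E].
have m_ge z : between z -> P (Some z) I <= m by move=> bz; apply: ereal_sup_ubound; exists z.
have m0 : 0 <= m by apply: le_trans (m_ge x0 _).
have m1 : m <= 1 by apply: ge_ereal_sup => _ [z _ <-]; exact: P_le1.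
have contr z : between z -> P (Some z) I <= m * (1 - delta).
  move=> [az zy].
  pose A : set Omega := [set w | (~ (up b y w <= n%:R%:E) /\ ~ (up (~~ b) a w <= n%:R%:E)) /\
    (X 0 w <> None /\ X n%:R%:E w <> None)].
  pose K : set (borel_cemetery E) := [set q | exists2 e, q = Some e & between e].
  (* [A] is needed both in the filtration at time n and in the sigma-algebra of the path space,
     hence the abstract [M]. *)
  have mA (M : set (set Omega)) : sigma_algebra setT M ->
      (forall b' z', M [set w | up b' z' w <= n%:R%:E]) ->
      (forall q, (0 <= q <= n%:R)%R -> M [set w | X q%:E w = None]) -> M A.
    move=> sM' Mup MX; apply: (sigma_and sM'); apply: (sigma_and sM'); apply: (sigma_not sM').
    - exact: Mup.
    - exact: Mup.
    - by apply: (MX 0%R); rewrite lexx ler0n.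
    - by apply: (MX n%:R); rewrite ler0n lexx.
  have mX q : (0 <= q)%R -> measurable ([set w | X q%:E w = None] : set (path_space X)).
    move=> q0; apply: (@measurable_coordinate _ _ _ X q%:E [set None]); first by rewrite lee_fin.
    exact: measurable_cemetery.
  have mA' : measurable (A : set (path_space X)).
    apply: (mA (@measurable _ (path_space X))); [exact: sM|by move=> *; exact: mup|].
    by move=> q /andP[q0 _]; exact: mX.
  have n0 : (0 <= n%:R :> R)%R by exact: ler0n.
  apply: (@le_trans _ _ (m * P (Some z) A)).
    pose H := [set w | I w /\ (X 0 w <> None /\ X n%:R%:E w <> None)].
    have mH : measurable (H : set (path_space X)).
      apply: (sigma_and sM) => //; apply: (sigma_and sM); apply: (sigma_not sM); apply: mX => //.
    rewrite (_ : P (Some z) I = P (Some z) H); last first.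
      rewrite -(completed_measureE (P (Some z)) mI) -(completed_measureE (P (Some z)) mH).
      apply: completed_ae_eq.
      apply: aeS (aeI (start_ae HX z) (alive_before_exit_ae az zy)) => w [X0 al].
      split=> [[Dy Da]|[]//]; split => //; split; first by rewrite X0.
      by apply: al => //; rewrite ?Dy ?Da ltry.
    apply: (@markov_bound _ _ _ X theta P HX z n%:R A I H K m) => //.
    - apply: mA; first exact: filtration_sigma_algebra.
        by move=> b' z'; apply: (stup b' z').2; rewrite lee_fin.
      move=> q qn; apply: (@filtration_coordinate _ _ _ X P q%:E _ [set None]).
        by rewrite !lee_fin.
      exact: measurable_cemetery.
    - rewrite (_ : K = [set q | ray b (dir b a) q /\ ray (~~ b) (dir (~~ b) y) q]).
        apply: (sigma_and (measurable_sigma_algebra (borel_cemetery E))); exact: measurable_ray.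
      apply/seteqP; split => q /=.
        by move=> [e -> [ae ey]]; split; exists e => //; rewrite dir_ltN.
      move=> [[e -> ae] [e' [<-]]]; rewrite dir_ltN => ey; by exists e.
    - move=> w [[/negP ny /negP na] [X0 Xn]]; case Xe : (X n%:R%:E w) => [e|//].
      exists e => //; rewrite -ltNge in ny; rewrite -ltNge in na; split.
        rewrite -dir_ltN; apply: le_lt_trans (_ : runsup (~~ b) (trajectory X w) n%:R < _).
          by apply: (runsup_ge _ X0 _ Xe); rewrite n0 lexx.
        by rewrite -entrance_gt.
      apply: le_lt_trans (_ : runsup b (trajectory X w) n%:R < _).
        by apply: (runsup_ge _ X0 _ Xe); rewrite n0 lexx.
      by rewrite -entrance_gt.
    - by move=> _ [e -> be]; exact: m_ge.
    move=> w [[Dy Da] [X0 Xn]]; split.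
      by split => //; rewrite Dy Da; split; apply/negP; rewrite -ltNge ltry.
    have := up_theta (b := b) (y := y) n0 X0 Xn; rewrite Dy ltry => /(_ isT) Dy'.
    have := up_theta (b := ~~ b) (y := a) n0 X0 Xn; rewrite Da ltry => /(_ isT) Da'.
    split.
      by case: (up b y (theta n%:R%:E w)) Dy'.
    by case: (up (~~ b) a (theta n%:R%:E w)) Da'.
  apply: lee_wpmul2l => //.
  apply: (@le_trans _ _ (P (Some z) (~` [set w | up b y w <= n%:R%:E]))).
    have mC : measurable (~` [set w | up b y w <= n%:R%:E] : set (path_space X)).
      by apply: measurableC; exact: mup.
    by apply: le_measure; rewrite ?inE// => w [[]].
  have PC : P (Some z) (~` [set w | up b y w <= n%:R%:E]) =
      1 - P (Some z) [set w | up b y w <= n%:R%:E].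
    rewrite -setTD measureD//; last first.
      by rewrite -ge0_fin_numE//; apply: P_fin; exact: measurableT.
    by rewrite setTI [X in X - _](prob_kernel (s := P) (Some z)).
  by rewrite PC; apply: leeB => //; exact: up_le_mono.
have mm : m <= m * (1 - delta) by apply: ge_ereal_sup => _ [z bz <-]; exact: contr.
apply/eqP; rewrite eq_le measure_ge0 andbT.
apply: (le_trans (m_ge x0 _)); first by [].
move: mm nP m0 m1; rewrite -/delta.
have := P_fin (Some a) (mup b y n%:R); rewrite -/delta.
case: (delta) => [r| |]//; case: (m) => [k| |]// _.
rewrite -EFinB -EFinM !lee_fin lte_fin => mm r0 k0 _.
rewrite leNgt; apply/negP => k0'; move: mm; rewrite leNgt => /negP; apply.
by rewrite gtr_pMr// gtrBl.
Qed.

Let exits_neq_ae b a x y : dir b a < dir b x -> dir b x < dir b y ->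
  {ae P (Some x), forall w, up b y w <> up (~~ b) a w}.
Proof.
move=> ax xy; have xa : dir (~~ b) x < dir (~~ b) a by rewrite dir_ltN.
have ya : y <> a by move=> ya; move: (lt_trans ax xy); rewrite ya ltxx.
apply: aeS (aeI (exits_ae ax xy) (up_neq xy xa ya)) => w [ex neq] Dya.
have [yoo|] := eqVneq (up b y w) +oo; first by apply: ex; rewrite -Dya.
by rewrite -ltey => /up_fin[t t0 Dt]; apply: (neq t Dt); rewrite -Dya.
Qed.

Lemma exits_up_compl b a x y : dir b a < dir b x -> dir b x < dir b y ->
  P (Some x) (exits_up (~~ b) y a) = 1 - P (Some x) (exits_up b a y).
Proof.
move=> ax xy; have mC := measurableC (mexits b a y).
transitivity (P (Some x) (~` exits_up b a y)).
  rewrite -(completed_measureE (P (Some x)) (mexits (~~ b) y a)).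
  rewrite -(completed_measureE (P (Some x)) mC).
  apply: completed_ae_eq; apply: aeS (exits_neq_ae ax xy) => w neq.
  rewrite /exits_up/= negbK; split=> [lt|/negP]; first by apply/negP; rewrite -leNgt ltW.
  by rewrite -leNgt le_eqVlt => /orP[/eqP ya|//]; case: neq.
rewrite -setTD measureD//; last first.
  by rewrite -ge0_fin_numE//; apply: P_fin; exact: measurableT.
by rewrite setTI [X in X - _](prob_kernel (s := P) (Some x)).
Qed.

(** As levels increase to y, the events of entering them before a decrease, up to a null set, to the
    same event for y. For a point z above such a level the probability is no larger than for the
    level. *)
Lemma exits_up_near b a x y (r : R) : dir b a < dir b x -> dir b x < dir b y ->
  P (Some x) (exits_up b a y) < r%:E ->
  \forall z \near y, P (Some x) (exits_up b a z) < r%:E.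
Proof.
move=> ax xy pr.
pose F n : set (path_space X) := [set w | entry X b (below (dir b y) n) w < up (~~ b) a w].
have mF n : measurable (F n) by exact: (measurable_entry_lt regX).
have mcapF : measurable (\bigcap_n F n) by exact: bigcapT_measurable.
have capF : P (Some x) (\bigcap_n F n) = P (Some x) (exits_up b a y).
  rewrite -(completed_measureE (P (Some x)) mcapF).
  rewrite -(completed_measureE (P (Some x)) (mexits b a y)).
  apply: completed_ae_eq; apply: aeS (exits_neq_ae ax xy) => w neq; split=> [h|h n _].
    rewrite /exits_up/= lt_neqAle; apply/andP; split; first exact/eqP.
    have := entrance_cvg (b := b) (c := dir b y) (regX w) => Dcvg.
    apply: (cvge_to_le Dcvg); apply: nearW => n; exact: ltW (h n I).
  apply: le_lt_trans h; apply: entrance_nd; have [->|] := eqVneq (dir b y) -oo; first by [].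
  by rewrite -ltNye => yN; apply/ltW/below_lt.
have Fcvg : P (Some x) (F n) @[n --> \oo] --> P (Some x) (exits_up b a y).
  rewrite -capF; apply: nonincreasing_cvg_mu => //.
    by rewrite -ge0_fin_numE//; exact: P_fin.
  move=> m n mn; apply/subsetPset => w /=; apply: le_lt_trans.
  by apply: entrance_nd; exact: below_nd.
have [n Fn] : exists n, P (Some x) (F n) < r%:E.
  have H : \forall n \near \oo, P (Some x) (F n) < r%:E.
    apply: (Fcvg [set v | v < r%:E]); apply: open_nbhs_nbhs; split => //.
    exact: open_ereal_lt_ereal.
  by have [n] := filter_ex H; exists n.
have : \forall z \near y, below (dir b y) n < dir b z.
  apply: (@dir_continuous _ _ b y [set v | below (dir b y) n < v]).
  apply: open_nbhs_nbhs; split; first exact: open_ereal_gt_ereal.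
  exact: below_lt (le_lt_trans (leNye _) xy).
apply: filterS => z nz; apply: le_lt_trans Fn; apply: le_measure; rewrite ?inE//.
by move=> w; apply: le_lt_trans; apply: entrance_nd; exact: ltW.
Qed.

Lemma hitting_exits x a y : set_val a < set_val x -> set_val x < set_val y ->
  @completed_measure_extension _ _ _ (P (Some x))
    [set w | hitting X (Some y) w < hitting X (Some a) w] =
  P (Some x) (exits_up false a y).
Proof.
move=> ax xy; have xa : dir true x < dir true a by rewrite (dir_ltN false).
rewrite -(completed_measureE (P (Some x)) (mexits false a y)).
apply: completed_ae_eq.
apply: aeS (aeI (hitting_entry_ae HX sfX nE (b := false) xy) (hitting_entry_ae HX sfX nE xa)).
by move=> w [Hy Ha] /=; rewrite Hy Ha.
Qed.

Definition exit_prob a x y : R := fine (P (Some x) (exits_up false a y)).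

Lemma exit_probE a x y : P (Some x) (exits_up false a y) = (exit_prob a x y)%:E.
Proof. by rewrite fineK// P_fin. Qed.

Lemma exit_prob_gt0 a x y : set_val a < set_val x -> set_val x < set_val y ->
  (0 < exit_prob a x y)%R.
Proof. by move=> ax xy; rewrite -lte_fin -exit_probE; exact: exits_up_gt0. Qed.

Lemma exit_prob_down a x y : set_val a < set_val x -> set_val x < set_val y ->
  P (Some x) (exits_up true y a) = (1 - exit_prob a x y)%:E.
Proof.
by move=> ax xy; rewrite (exits_up_compl (b := false) ax xy) exit_probE EFinB.
Qed.

Lemma exit_prob_lt1 a x y : set_val a < set_val x -> set_val x < set_val y ->
  (exit_prob a x y < 1)%R.
Proof.
move=> ax xy; rewrite -subr_gt0 -lte_fin -exit_prob_down//.
by apply: exits_up_gt0; rewrite (dir_ltN false).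
Qed.

Lemma exit_prob_mul a x y z :
  set_val a < set_val x -> set_val x < set_val y -> set_val y < set_val z ->
  exit_prob a x z = (exit_prob a x y * exit_prob a y z)%R.
Proof.
move=> ax xy yz; apply: EFin_inj; rewrite EFinM -!exit_probE.
exact: (exits_up_mul (b := false)).
Qed.

(** Descending from y to a before z requires passing x: this is [exits_up_mul] in the reversed
    direction. *)
Lemma exit_prob_mulC a x y z :
  set_val a < set_val x -> set_val x < set_val y -> set_val y < set_val z ->
  (1 - exit_prob a y z = (1 - exit_prob x y z) * (1 - exit_prob a x z))%R.
Proof.
move=> ax xy yz; apply: EFin_inj; rewrite EFinM.
rewrite -!exit_prob_down ?(lt_trans ax xy) ?(lt_trans xy yz)//.
by apply: exits_up_mul; rewrite (dir_ltN false).
Qed.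

End skip_free_hunt_processes.

(** * The scale function *)

Section scale_from_exit_probabilities.
Context {R : realType} {E : set (\bar R)}.
Implicit Types a c d x y z : E.
Variable p : E -> E -> E -> R.
Local Notation "x <E y" := (set_val x < set_val y) (at level 70).
Local Notation "x <=E y" := (set_val x <= set_val y) (at level 70).
Hypothesis p_gt0 : forall a x y, a <E x -> x <E y -> (0 < p a x y)%R.
Hypothesis p_lt1 : forall a x y, a <E x -> x <E y -> (p a x y < 1)%R.
Hypothesis p_mul : forall a x y z, a <E x -> x <E y -> y <E z ->
  p a x z = (p a x y * p a y z)%R.
Hypothesis p_mulC : forall a x y z, a <E x -> x <E y -> y <E z ->
  (1 - p a y z = (1 - p x y z) * (1 - p a x z))%R.

(** The scale identity with its denominator cleared, restricted to [S] because the functions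
    available at first satisfy it on an interval only. *)
Definition harmonic_on (S : set E) (h : E -> R) :=
  (forall x y, S x -> S y -> x <E y -> (h x < h y)%R) /\
  (forall a x y, S a -> S x -> S y -> a <E x -> x <E y ->
    (p a x y * (h y - h a) = h x - h a)%R).

(* The value at z of a harmonic function equal to 0 at c and to 1 at d, solved
   from the single relation between c, d and z. *)
Definition normalized_scale c d z : R :=
  (if z <E c then - p z c d / (1 - p z c d)
   else if set_val z == set_val c then 0
   else if z <E d then p c z d
   else if set_val z == set_val d then 1
   else (p c d z)^-1)%R.

(** The identity for the three points c, d, z, taken in their order, is linear in h z. This yields
    both the uniqueness of the scale function and the compatibility of the local ones. *)
Lemma harmonic_normalized (S : set E) h c d z : harmonic_on S h -> c <E d ->
  S c -> S d -> S z -> (h z = (h d - h c) * normalized_scale c d z + h c)%R.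
Proof.
move=> [hlt hp] cd Sc Sd Sz; have hcd := hlt _ _ Sc Sd cd.
rewrite /normalized_scale; case: (ltgtP (set_val z) (set_val c)) => [zc|cz|/val_inj ->].
- have := hp _ _ _ Sz Sc Sd zc cd; have := p_lt1 zc cd.
  set q := p z c d => q1 qE; have q1' : (1 - q != 0)%R by rewrite subr_eq0 gt_eqF.
  apply: (mulfI q1').
  have -> : ((1 - q) * ((h d - h c) * (- q / (1 - q)) + h c) =
     - (h d - h c) * q + (1 - q) * h c)%R by field.
  lra.
- case: (ltgtP (set_val z) (set_val d)) => [zd|dz|/val_inj ->].
  + by have := hp _ _ _ Sc Sz Sd cz zd; lra.
  + have := hp _ _ _ Sc Sd Sz cd dz; have := p_gt0 cd dz.
    set q := p c d z => q0 qE; have q0' : (q != 0)%R by rewrite gt_eqF.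
    apply: (mulfI q0').
    have -> : (q * ((h d - h c) * q^-1 + h c) = (h d - h c) + q * h c)%R by field.
    lra.
  + lra.
- lra.
Qed.

(** The local candidate on [A,B]: [p A z B] completed by its boundary values 0 and 1. *)
Let hit A B z : R :=
  if set_val z <= set_val A then 0%R else if set_val z < set_val B then p A z B else 1%R.

Let hit_mul A B x y : A <E x -> x <E y -> y <=E B -> (hit A B x = p A x y * hit A B y)%R.
Proof.
move=> Ax xy yB; have xB := lt_le_trans xy yB; have Ay := lt_trans Ax xy.
rewrite /hit !leNgt Ax Ay xB/=; case: ifPn => [yB'|]; first exact: p_mul.
rewrite -leNgt => By; have -> : y = B by apply: val_inj; apply/eqP; rewrite eq_le yB.
by rewrite mulr1.
Qed.

Let hit_gt0 A B x : A <E x -> (0 < hit A B x)%R.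
Proof. by move=> Ax; rewrite /hit leNgt Ax/=; case: ifPn => // xB; exact: p_gt0. Qed.

Let hit0 A B : hit A B A = 0%R. Proof. by rewrite /hit lexx. Qed.

Let harmonic_hit A B : harmonic_on [set z | A <=E z /\ z <=E B] (hit A B).
Proof.
split=> [x y [Ax xB] [Ay yB] xy|a x y [Aa aB] [Ax xB] [Ay yB] ax xy].
  move: Ax; rewrite le_eqVlt => /orP[/eqP/val_inj Ax|Ax].
    by rewrite -Ax in xy *; rewrite hit0; exact: hit_gt0.
  rewrite (hit_mul Ax xy yB) gtr_pMl; first exact: p_lt1.
  exact/hit_gt0/(lt_trans Ax).
have Ax' : A <E x by exact: le_lt_trans Aa ax.
move: Aa; rewrite le_eqVlt => /orP[/eqP/val_inj Aa|Aa].
  by rewrite -Aa in ax *; rewrite hit0 !subr0 -hit_mul.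
have ay := lt_trans ax xy.
(* After factoring out [hit A B y] the claim is p a x y * (1 - p A a y) = p A x y - p A a y, a form
   of [p_mulC]. *)
rewrite (hit_mul Aa ay yB) (hit_mul Ax' xy yB).
have := p_mulC Aa ax xy; nra.
Qed.

(** E may have no extreme points, so a single [hit A B] need not cover it. Any a and y fit together
    with c and d into [mn a, mx y]; there [hit] is an increasing affine function of the normalised
    scale, which thus inherits its properties. *)
Lemma normalized_scale_harmonic c d : c <E d -> harmonic_on setT (normalized_scale c d).
Proof.
move=> cd; pose mn x := if set_val x < set_val c then x else c.
pose mx x := if set_val x < set_val d then d else x.
have mnl x : mn x <=E x by rewrite /mn; case: ltP => // _; exact: lexx.
have mnc x : mn x <=E c by rewrite /mn; case: ltP => // /ltW.
have mxr x : x <=E mx x by rewrite /mx; case: ltP => // /ltW.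
have mxd x : d <=E mx x by rewrite /mx; case: ltP.
have key a y : a <E y -> harmonic_on [set z | a <=E z /\ z <=E y] (normalized_scale c d).
  move=> ay; pose S : set E := [set z : E | mn a <=E z /\ z <=E mx y].
  have hS : harmonic_on S (hit (mn a) (mx y)) by exact: harmonic_hit.
  have Sc : S c by split => //; exact: le_trans (ltW cd) (mxd y).
  have Sd : S d by split => //; exact: le_trans (mnc a) (ltW cd).
  have Sz z : a <=E z -> z <=E y -> S z.
    by move=> az zy; split; [exact: le_trans az|exact: le_trans (mxr y)].
  have hE z : S z -> hit (mn a) (mx y) z = ((hit (mn a) (mx y) d - hit (mn a) (mx y) c)
      * normalized_scale c d z + hit (mn a) (mx y) c)%R.
    by move=> sz; exact: harmonic_normalized hS cd Sc Sd sz.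
  have [hlt hp] := hS; have hcd := hlt _ _ Sc Sd cd.
  move: hE hlt hp hcd; set h := hit _ _ => hE hlt hp.
  rewrite -subr_gt0; set k := (h d - h c)%R => k0.
  split=> [u v [au uy] [av vy] uv|u v w [au uy] [av vy] [aw wy] uv vw].
    have := hlt u v (Sz _ au uy) (Sz _ av vy) uv.
    by rewrite (hE _ (Sz _ au uy)) (hE _ (Sz _ av vy)) ltrD2r ltr_pM2l.
  have := hp u v w (Sz _ au uy) (Sz _ av vy) (Sz _ aw wy) uv vw.
  rewrite (hE _ (Sz _ au uy)) (hE _ (Sz _ av vy)) (hE _ (Sz _ aw wy)) => e.
  apply: (mulfI (lt0r_neq0 k0)).
  have cancel_r (m n q : R) : (m + q - (n + q) = m - n)%R by ring.
  by move: e; rewrite !cancel_r -!mulrBr mulrCA.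
split=> [x y _ _ xy|a x y _ _ _ ax xy].
  by have [+ _] := key x y xy; apply => //=; rewrite lexx (ltW xy).
have ay := lt_trans ax xy.
by have [_ +] := key a y ay; apply => //=; rewrite ?lexx ?(ltW ax) ?(ltW xy) ?(ltW ay).
Qed.

End scale_from_exit_probabilities.

(** * Continuity of the scale function *)

Section scale_continuity.
Context {R : realType} {E : set (\bar R)} {Omega : pointedType}.
Variables (X : \bar R -> Omega -> cemetery E) (theta : \bar R -> Omega -> Omega).
Variable P : R.-pker (borel_cemetery E) ~> (path_space X).
Hypotheses (nE : nearly_closed E) (sfhX : skip_free_hunt theta P).
Implicit Types (a x y z : E) (b : bool).
Variable s : E -> R.
Hypothesis hs : harmonic_on (exit_prob P) setT s.

Let sdir b z : R := if b then (- s z)%R else s z.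

Let sdir_lt b x y : dir b x < dir b y -> (sdir b x < sdir b y)%R.
Proof. by case: b; rewrite /dir /sdir ?lteN2 ?ltrN2 => xy; exact: hs.1. Qed.

Let sdir_le b x y : dir b x <= dir b y -> (sdir b x <= sdir b y)%R.
Proof. by rewrite le_eqVlt => /orP[/eqP/dir_inj ->//|/sdir_lt/ltW]. Qed.

Let exits_sdir b a x y : dir b a < dir b x -> dir b x < dir b y ->
  P (Some x) (exits_up X b a y) = ((sdir b x - sdir b a) / (sdir b y - sdir b a))%:E.
Proof.
move=> ax xy; have ay := lt_trans ax xy.
have : (sdir b y - sdir b a != 0)%R by rewrite subr_eq0 gt_eqF// sdir_lt.
case: b ax xy ay => /=; rewrite /dir /sdir ?lteN2 => ax xy ay ne.
  rewrite (exit_prob_down nE sfhX)//; congr EFin.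
  have := hs.2 y x a I I I xy ax => e; apply: (mulIf ne); rewrite mulfVK//; lra.
rewrite (exit_probE sfhX); congr EFin.
by apply: (mulIf ne); rewrite mulfVK//; exact: hs.2.
Qed.

(** With a and x fixed before y, the probability of reaching z before a is inversely proportional to
    the increment of s from a to z. An upper bound on it for z near y therefore keeps this increment
    from dropping below the one at y by more than e. *)
Let one_sided b y (e : R) : (0 < e)%R ->
  \forall z \near y, dir b z <= dir b y -> (`|s z - s y| < e)%R.
Proof.
move=> e0.
have [[x [a [ax xy]]]|nox] :=
  pselect (exists x a, dir b a < dir b x /\ dir b x < dir b y); last first.
  (* At most one point of E precedes y in this direction, so no other point close to y lies on that
     side. *)
  have [[x xy]|nx] := pselect (exists x, dir b x < dir b y); last first.
    apply: (@filterE _ (nbhs y)) => z.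
    rewrite le_eqVlt => /orP[/eqP/dir_inj ->|zy]; first by rewrite subrr normr0.
    by exfalso; apply: nx; exists z.
  have : \forall z \near y, dir b x < dir b z.
    apply: (@dir_continuous _ _ b y [set v | dir b x < v]).
    by apply: open_nbhs_nbhs; split => //; exact: open_ereal_gt_ereal.
  apply: filterS => z xz.
  rewrite le_eqVlt => /orP[/eqP/dir_inj ->|zy]; first by rewrite subrr normr0.
  by exfalso; apply: nox; exists z, x.
have sxa := sdir_lt ax; have sxy := sdir_lt xy.
pose k := (sdir b x - sdir b a)%R; pose m := (sdir b y - sdir b a)%R.
have k0 : (0 < k)%R by rewrite subr_gt0.
have m0 : (0 < m)%R by rewrite subr_gt0 (lt_trans sxa).
(* Capping by m / 2 keeps the denominator m - e' positive. *)
pose e' := Num.min e (m / 2)%R.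
have e'0 : (0 < e')%R by rewrite lt_min e0 divr_gt0.
have e'e : (e' <= e)%R by rewrite ge_min lexx.
have e'm : (e' < m)%R.
  by rewrite gt_min; apply/orP; right; rewrite ltr_pdivrMr// ltr_pMr// ltr1n.
have me'0 : (0 < m - e')%R by rewrite subr_gt0.
have lt_r : P (Some x) (exits_up X b a y) < (k / (m - e'))%:E.
  rewrite exits_sdir// lte_fin ltr_pM2l// ltf_pV2 ?posrE//.
  by rewrite -/m gtrBl.
have N1 := exits_up_near nE sfhX ax xy lt_r.
have N2 : \forall z \near y, dir b x < dir b z.
  apply: (@dir_continuous _ _ b y [set v | dir b x < v]).
  by apply: open_nbhs_nbhs; split => //; exact: open_ereal_gt_ereal.
apply: filterS2 N1 N2 => z pz xz zy.
have sxz := sdir_lt xz.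
move: pz; rewrite exits_sdir// lte_fin ltr_pM2l// ltf_pV2 ?posrE//; last first.
  by rewrite subr_gt0 (lt_trans sxa).
move=> lt_e; have le_s := sdir_le zy.
have -> : (`|s z - s y| = sdir b y - sdir b z)%R.
  by move: le_s; rewrite /sdir; case: (b) => le_s; [rewrite ger0_norm|rewrite ler0_norm]; lra.
by move: lt_e e'e; rewrite /m; lra.
Qed.

Lemma harmonic_continuous : continuous s.
Proof.
move=> y; apply/(@cvgrPdist_lt _ _ _ (nbhs y)) => e e0.
apply: filterS2 (one_sided false y e0) (one_sided true y e0) => z up down.
rewrite distrC; have [zy|yz] := leP (set_val z) (set_val y); first exact: up.
by apply: down; rewrite /dir leeN2 ltW.
Qed.

End scale_continuity.

Local Close Scope ereal_scope.

Theorem theorem2p5 (R : realType) (E : set (\bar R)) (Omega : pointedType)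
    (X : \bar R -> Omega -> cemetery E) (theta : \bar R -> Omega -> Omega)
    (P : R.-pker (borel_cemetery E) ~> (path_space X)) :
  nearly_closed E ->
  skip_free_hunt theta P ->
  exists s : E -> R,
    scale_function P s /\
    forall s' : E -> R, scale_function P s' ->
      exists alpha beta : R,
        0 < alpha /\ forall x : E, s' x = alpha * s x + beta.
Proof.
move=> nE sfhX.
(* Hitting and entrance times agree almost surely, so the scale identity can be stated for the exit
   probabilities. *)
have scale_harmonic (s : E -> R) : scale_function P s <->
    continuous s /\ harmonic_on (exit_prob P) setT s.
  have quot a x b : (set_val a < set_val x)%E -> (set_val x < set_val b)%E ->
      (s a < s b) -> (exit_prob P a x b * (s b - s a) = s x - s a) <->
      exit_prob P a x b = ((s x - s a) / (s b - s a)).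
    move=> ax xb ab; have ne : (s b - s a != 0) by rewrite subr_eq0 gt_eqF.
    by split=> [<-|->]; [rewrite mulfK|rewrite mulfVK].
  split=> [[cs ss ps]|[cs [ss ps]]].
    split => //; split=> [x y _ _|a x b _ _ _ ax xb]; first exact: ss.
    have ab := lt_trans ax xb.
    apply/quot => //; first exact: ss.
    have := ps a x b; rewrite ax xb => /(_ isT).
    by rewrite (hitting_exits nE sfhX)// (exit_probE sfhX) => -[].
  split => //; first by move=> x y; exact: ss.
  move=> a x b /andP[ax xb]; have ab := lt_trans ax xb.
  rewrite (hitting_exits nE sfhX)// (exit_probE sfhX); congr EFin.
  by apply/quot => //; [exact: ss|exact: ps].
(* If E has at most one point, the conditions are void and the zero function serves; beta is the
   value of s' at the only point, or 0 if E is empty. *)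
have [[c [d cd]]|one] := pselect (exists c d : E, (set_val c < set_val d)%E); last first.
  have eqE (x y : E) : x = y.
    apply: val_inj; apply/eqP; rewrite eq_le !leNgt; apply/andP.
    by split; apply/negP => lt; apply: one; [exists y, x|exists x, y].
  exists (fun=> 0); split.
    apply/scale_harmonic; split; first by move=> x; exact: cst_continuous.
    by split=> [x y _ _|a x b _ _ _]; [rewrite (eqE x y)|rewrite (eqE x a)]; rewrite ltxx.
  move=> s' _; have [[x0 _]|nx] := pselect (exists x : E, True).
    by exists 1, (s' x0); split => // x; rewrite mulr0 add0r (eqE x x0).
  by exists 1, 0; split => // x; exfalso; apply: nx; exists x.
have p_gt0 := exit_prob_gt0 nE sfhX; have p_lt1 := exit_prob_lt1 nE sfhX.
have harm := normalized_scale_harmonic p_gt0 p_lt1 (exit_prob_mul nE sfhX)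
  (exit_prob_mulC nE sfhX) cd.
exists (normalized_scale (exit_prob P) c d); split.
  by apply/scale_harmonic; split => //; exact: harmonic_continuous nE sfhX _ harm.
move=> s' /scale_harmonic[_ harm'].
(* The scale is normalised to 0 at c and 1 at d, so the affine relation is read off at these two
   points. *)
exists (s' d - s' c), (s' c); split; first by rewrite subr_gt0; exact: harm'.1.
by move=> x; exact: (harmonic_normalized p_gt0 p_lt1 harm' cd).
Qed.
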